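(* For a restricted graph $G=(V,E,w)$ with $n$ vertices and $m$ edges, the algorithm $\textsc{RestrictedSSSP}(G)$ described below computes a potential $\phi:V\to\mathbb{Z}$ such that, with high probability, $w_\phi(e)=w(e)+\phi(u)-\phi(v)\ge 0$ for all edges $e=(u,v)\in E$. The algorithm has work $W_{\geq 0}(n,m)\cdot\mathrm{poly}(\log n)$ and span $S_{\geq 0}(n,m)\cdot\mathrm{poly}(\log n)$.
   Context: A directed integer-weighted graph $G=(V,E,w)$ on $n$ vertices is restricted if $w(e)\in\{-1,0,\dots,n\}$ for all edges and every directed cycle $C$ has $\sum_{e\in C}w(e)\ge |C|$. $G_{\ge0}$ is $G$ with weights $w_{\ge0}(e)=\max(0,w(e))$; $G[S]$ is the induced subgraph. $\mathrm{dist}_H(S,v)=\min_{u\in S}\mathrm{dist}_H(u,v)$. ''With high probability'' means with probability at least $1-n^{-c}$ for an arbitrarily large prespecified constant $c$ (here $c=c_{\mathrm{whp}}$). Model: PRAM. $W_{\ge0}(n,m)$, $S_{\ge0}(n,m)$ are the work and span of a given parallel Nonnegative-Weight SSSP algorithm, assumed to satisfy $W_{\geq 0}(n_1,m_1)+W_{\geq 0}(n_2,m_2)\le W_{\geq 0}(n_1+n_2,m_1+m_2)$ and $\max(S_{\geq 0}(n_1,m_1),S_{\geq 0}(n_2,m_2))\le S_{\geq 0}(n_1+n_2,m_1+m_2)$. Subroutines. $\textsc{DirLDD}(H,d)$, for a directed graph $H$ with nonnegative polynomially bounded integer weights and $d\ge1$, is a randomized procedure (with fresh independent randomness per call) returning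 an ordered partition $(S_1,\dots,S_k)$ of the vertex set such that: every $S_i$ has $\mathrm{dist}_H(u,v)\le d$ and $\mathrm{dist}_H(v,u)\le d$ for all $u,v\in S_i$; an edge $e=(u,v)$ with $u\in S_i,v\in S_j$ is called cut if $i>j$, and each edge is cut with probability at most $Q(n)\cdot w(e)/d+O(n^{-8})$ where $Q(n)=O(\log^2 n)$; if every pair of mutually reachable vertices is within distance $d$ in both directions, no edge is cut; it has work $W_{\ge0}(n,m)\mathrm{poly}(\log n)$ and span $S_{\ge0}(n,m)\mathrm{poly}(\log n)$. $\textsc{FewNegSSSP}(H,\phi,t)$, for a graph $H=(V_H,E_H,w)$ without negative cycles, potential $\phi$ and integer $t\ge0$, returns $\boldsymbol d:V_H\to\mathbb{Z}$ with $\mathrm{dist}_H(V_H,v)\le\boldsymbol d(v)$ and $\boldsymbol d(v)\le w(P)$ for every path $P$ in $H$ ending in $v$ with at most $t$ edges of negative $w_\phi$-weight, using work $O(W_{\ge0}(nt,mt))$ and span $O(S_{\ge0}(nt,mt))$ on $n$-vertex $m$-edge inputs. Algorithm $\textsc{RestrictedSSSP}(G)$: set $L=\lceil\log(2n^2)\rceil$, $R=(2+c_{\mathrm{whp}})\log n$, $t=4Q(n)+1$, and $\Phi_0=\{0\}$ (the all-zero potential). For $\ell=1,\dots,L$: for $r=1,\dots,R$: compute $\mathcal S_{\ell,r}=(S_1,\dots,S_k)\leftarrow\textsc{DirLDD}(G_{\ge0},2^\ell)$; in parallel for each $i\in[k]$, compute $\boldsymbol d_\phi\leftarrow\textsc{FewNegSSSP}(G[S_i],\phi,t)$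 for each $\phi\in\Phi_{\ell-1}$ and set $\phi^{(i)}(v)=\min_{\phi\in\Phi_{\ell-1}}\boldsymbol d_\phi(v)$ for $v\in S_i$; then define $\phi_{\ell,r}(v)=\phi^{(i)}(v)-i\cdot n$ for $v\in S_i$. After the inner loop set $\Phi_\ell=\{\phi_{\ell,r}:r\in[R]\}$. Finally return $\phi_{L,1}$.
   Formalization: Added assumptions: W(n,m) ≥ n+m, S(n,m) ≥ 1 for n ≥ 1, and W(nt,mt) ≤ W(n,m)·poly(log n), likewise for S, when t ≤ poly(log n); without the scaling bound the cost claim fails. The success probability is claimed for all sufficiently large n. *)

(* Defs.v *)
From HB Require Import structures.
From mathcomp Require Import all_boot all_order all_algebra.
From mathcomp Require Import all_classical all_reals all_analysis.

Set Implicit Arguments.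
Unset Strict Implicit.
Unset Printing Implicit Defensive.

Import Order.TTheory GRing.Theory Num.Theory.
Import numFieldNormedType.Exports.

Local Open Scope ring_scope.

(* All graphs over [T] share the ambient type [T] but have their own vertex set
   [vset], so that an induced subgraph of [G : graph T] is again a [graph T].
   Weights and potentials are total functions of which only the values on
   [eset], respectively [vset], matter. *)
Record graph (T : finType) := Graph {
  vset : {set T};
  eset : {set T * T};
  wt : T * T -> int;
  eset_sub : eset \subset finset.setX vset vset }.

Definition potential (T : finType) := T -> int.

Section Graphs.
Variable T : finType.
Implicit Types (G H : graph T) (S : {set T}) (u v : T) (p : seq T).

Definition nverts G : nat := #|vset G|.
Definition nedges G : nat := #|eset G|.

Definition nonneg_part G : graph T :=
  @Graph T (vset G) (eset G) (fun e => Num.max 0 (wt G e)) (eset_sub G).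

Fact induced_sub G S :
  eset G :&: finset.setX S S \subset finset.setX (vset G :&: S) (vset G :&: S).
Proof.
apply/fintype.subsetP => -[x y]; rewrite !inE => /andP[/(fintype.subsetP (eset_sub G))].
by rewrite !inE /= => /andP[-> ->] /andP[-> ->].
Qed.

Definition induced_subgraph G S : graph T :=
  @Graph T (vset G :&: S) (eset G :&: finset.setX S S) (wt G) (induced_sub G S).

Definition erel G : rel T := [rel x y | (x, y) \in eset G].

(* The path with successive vertices [u :: p]. *)
Definition dipath G u p v : bool :=
  [&& u \in vset G, path (erel G) u p & last u p == v].

Definition path_edges u p : seq (T * T) := pairmap pair u p.

Definition cycle_edges (c : seq T) : seq (T * T) :=
  if c is x :: p then path_edges x (rcons p x) else [::].

Definition weight G (es : seq (T * T)) : int := \sum_(e <- es) wt G e.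

Definition dicycle G (c : seq T) : bool :=
  [&& c != [::], cycle (erel G) c & uniq c].

Definition no_negative_cycle G : Prop :=
  forall c, dicycle G c -> 0 <= weight G (cycle_edges c).

Definition restricted G : Prop :=
  (forall e, e \in eset G -> -1 <= wt G e <= (nverts G)%:Z) /\
  (forall c, dicycle G c -> (size c)%:Z <= weight G (cycle_edges c)).

Definition wt_pot G (phi : potential T) (e : T * T) : int :=
  wt G e + phi e.1 - phi e.2.

Definition feasible G (phi : potential T) : bool :=
  [forall e in eset G, 0 <= wt_pot G phi e].

Definition neg_count G (phi : potential T) (es : seq (T * T)) : nat :=
  count (fun e => wt_pot G phi e < 0) es.

(* Infimum over all walks: [+oo] for an unreachable target, and [-oo] for one
   that is reachable through a negative cycle. *)
Definition dist (R : realType) G u v : \bar R :=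
  ereal_inf [set (weight G (path_edges u p))%:~R%:E | p in
               [set p | dipath G u p v]]%classic.

Definition dist_from (R : realType) G S v : \bar R :=
  \big[mine/+oo%E]_(u in S) dist R G u v.

Definition mutually_reachable G u v : bool :=
  connect (erel G) u v && connect (erel G) v u.

Definition ordered_partition (P : seq {set T}) (D : {set T}) : bool :=
  uniq P && finset.partition [set:: P] D.

(* The position, counted from 0, of the block of [P] that contains [v]. *)
Definition block_index (P : seq {set T}) v : nat :=
  find (fun S : {set T} => v \in S) P.

Definition is_cut (P : seq {set T}) (e : T * T) : bool :=
  (block_index P e.2 < block_index P e.1)%N.

End Graphs.

(* A finite probability space of seeds together with the result as a function
   of the seed.  Finiteness loses nothing for a procedure with finitely many
   possible results, in particular for one with worst-case bounds on its work
   that returns a partition of a finite set. *)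
Record rcomp (R : realType) (A : Type) := RComp {
  seed : finType;
  prob : seed -> R;
  prob_gt0 : forall s, 0 < prob s;
  prob_sum1 : \sum_s prob s = 1;
  run : seed -> A }.

Definition Pr (R : realType) (A : Type) (c : rcomp R A) (E : pred A) : R :=
  \sum_(s : seed c | E (run s)) prob s.

Definition always (R : realType) (A : Type) (c : rcomp R A) (P : A -> Prop) :
  Prop := forall s : seed c, P (run s).

Section RandomMonad.
Variable R : realType.

Fact rret_gt0 (s : unit) : 0 < 1 :> R. Proof. exact: ltr01. Qed.
Fact rret_sum1 : \sum_(s : unit) 1 = 1 :> R.
Proof. by rewrite sumr_const card_unit. Qed.

Definition rret (A : Type) (a : A) : rcomp R A :=
  @RComp R A unit (fun=> 1) rret_gt0 rret_sum1 (fun=> a).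

Section Bind.
Variables (A B : Type) (c : rcomp R A) (f : A -> rcomp R B).

(* The seed of [f] is drawn afresh, independently of the seed of [c]. *)
Definition bind_seed : finType := {s : seed c & seed (f (run s))}.
Definition bind_prob (s : bind_seed) : R := prob (tag s) * prob (tagged s).
Definition bind_run (s : bind_seed) : B := run (tagged s).

Fact bind_gt0 s : 0 < bind_prob s.
Proof. by rewrite mulr_gt0 ?prob_gt0. Qed.

Fact bind_sum1 : \sum_s bind_prob s = 1.
Proof.
rewrite -(prob_sum1 c).
rewrite -(@sig_big_dep _ _ _ _ _ predT (fun _ => predT)
  (fun (i : seed c) (j : seed (f (run i))) => prob i * prob j)) /=.
by apply: eq_bigr => i _; rewrite -big_distrr /= prob_sum1 mulr1.
Qed.

Definition rbind : rcomp R B := RComp bind_gt0 bind_sum1 bind_run.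
End Bind.

Definition rmap (A B : Type) (g : A -> B) (c : rcomp R A) : rcomp R B :=
  @RComp R B (seed c) (@prob R A c) (@prob_gt0 R A c) (@prob_sum1 R A c)
    (fun s => g (run s)).

End RandomMonad.

Record timed (A : Type) := Timed { tvalue : A; twork : nat; tspan : nat }.

(* A randomized parallel program: the cost may depend on the random seed. *)
Definition prog (R : realType) (A : Type) := rcomp R (timed A).

Section Programs.
Variable R : realType.

Definition det (A : Type) (a : timed A) : prog R A := rret R a.

Definition ret (A : Type) (a : A) : prog R A := det (Timed a 0 0).

Definition seqc (A B : Type) (c : prog R A) (f : A -> prog R B) : prog R B :=
  rbind c (fun a => rmap
    (fun b => Timed (tvalue b) (twork a + twork b) (tspan a + tspan b))
    (f (tvalue a))).

Definition tick (w s : nat) : prog R unit := det (Timed tt w s).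

Fixpoint seq_all (A : Type) (cs : seq (prog R A)) : prog R (seq A) :=
  if cs is c :: cs' then
    seqc c (fun a => seqc (seq_all cs') (fun l => ret (a :: l)))
  else ret [::].

Fixpoint join_all (A : Type) (cs : seq (prog R A)) : prog R (seq A) :=
  if cs is c :: cs' then
    rbind c (fun a => rmap
      (fun b => Timed (tvalue a :: tvalue b)
                  (twork a + twork b) (maxn (tspan a) (tspan b)))
      (join_all cs'))
  else ret [::].

Fixpoint loop (A I : Type) (idx : seq I) (f : I -> A -> prog R A) (a : A) :
  prog R A :=
  if idx is i :: idx' then seqc (f i a) (loop idx' f) else ret a.

(* Costs of the PRAM primitives, in terms of the bound [tau] on the time of a
   constant-time step: [k] such steps in parallel, ... *)
Definition elementwise (tau k : nat) : prog R unit := tick (tau * k) tau.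

(* ... sorting [k] keys, which is used to split vertex and edge lists by
   block, ... *)
Definition sorting (tau k : nat) : prog R unit :=
  tick (tau * k * (up_log 2 k).+1) (tau * (up_log 2 k).+1).

(* ... and starting a list of programs in parallel by binary forking. *)
Definition par_all (tau : nat) (A : Type) (cs : seq (prog R A)) :
  prog R (seq A) :=
  seqc (tick (tau * size cs) (tau * (up_log 2 (size cs)).+1))
    (fun=> join_all cs).

End Programs.

Notation "x <-- c ;; d" := (seqc c (fun x => d))
  (at level 61, c at next level, right associativity,
   format "'[v' x  <--  c  ;; '/' d ']'").

Definition log2 (R : realType) (n : nat) : R := ln n%:R / ln 2.

Definition le_polylog (R : realType) (p : {poly R}) (n : nat) (x y : nat) :
  Prop := x%:R <= y%:R * p.[log2 R n].

Definition superadditive (W : nat -> nat -> nat) : Prop :=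
  forall n1 m1 n2 m2, (W n1 m1 + W n2 m2 <= W (n1 + n2) (m1 + m2))%N.

Definition max_superadditive (S : nat -> nat -> nat) : Prop :=
  forall n1 m1 n2 m2, (maxn (S n1 m1) (S n2 m2) <= S (n1 + n2) (m1 + m2))%N.

(* Superadditivity bounds [F (n * t) (m * t)] only from below; this is the
   regularity needed to absorb a polylogarithmic blow-up [t] of the input into
   a factor poly(log n). *)
Definition polylog_scaling (R : realType) (F : nat -> nat -> nat) : Prop :=
  forall q : {poly R}, exists p : {poly R}, forall n m t : nat,
    (0 < n)%N -> t%:R <= q.[log2 R n] ->
    le_polylog p n (F (n * t) (m * t))%N (F n m).

Definition dirldd_proc (R : realType) :=
  forall T : finType, graph T -> nat -> prog R (seq {set T}).

(* The constants hidden in the asymptotic notation may depend on the degree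
   [k] of the polynomial that bounds the weights. *)
Definition dirldd_spec (R : realType) (W S : nat -> nat -> nat)
    (Q : nat -> nat) (dirldd : dirldd_proc R) : Prop :=
  forall k : nat, exists (K : R) (p : {poly R}),
  forall (T : finType) (H : graph T) (d : nat),
    (forall e, e \in eset H -> 0 <= wt H e <= (nverts H ^ k)%:Z) ->
    (1 <= d)%N ->
    let n := nverts H in
    let m := nedges H in
    [/\ always (dirldd T H d) (fun o => ordered_partition (tvalue o) (vset H)),
        always (dirldd T H d) (fun o =>
          forall A : {set T}, A \in tvalue o ->
          forall u v, u \in A -> v \in A ->
            (dist R H u v <= d%:R%:E)%E /\ (dist R H v u <= d%:R%:E)%E),
        forall e, e \in eset H ->
          Pr (dirldd T H d) (fun o => is_cut (tvalue o) e)
            <= (Q n)%:R * (wt H e)%:~R / d%:R + K / n%:R ^+ 8,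
        (forall u v, u \in vset H -> v \in vset H ->
           mutually_reachable H u v ->
           (dist R H u v <= d%:R%:E)%E /\ (dist R H v u <= d%:R%:E)%E) ->
        always (dirldd T H d) (fun o =>
          forall e, e \in eset H -> ~~ is_cut (tvalue o) e)
      & (0 < n)%N ->
        always (dirldd T H d) (fun o =>
          le_polylog p n (twork o) (W n m) /\ le_polylog p n (tspan o) (S n m))].

Definition fewneg_proc :=
  forall T : finType, graph T -> potential T -> nat -> timed (potential T).

(* The cost bounds are only required for nonempty inputs: superadditivity
   forces [W 0 0 = 0]. *)
Definition fewneg_spec (R : realType) (W S : nat -> nat -> nat)
    (fewneg : fewneg_proc) : Prop :=
  exists C : nat,
  forall (T : finType) (H : graph T) (phi : potential T) (t : nat),
    no_negative_cycle H ->
    let n := nverts H in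
    let m := nedges H in
    let d := tvalue (fewneg T H phi t) in
    [/\ forall v, v \in vset H ->
          (dist_from R H (vset H) v <= (d v)%:~R%:E)%E,
        forall u p v, dipath H u p v ->
          (neg_count H phi (path_edges u p) <= t)%N ->
          d v <= weight H (path_edges u p),
        (0 < n)%N -> (0 < t)%N ->
          (twork (fewneg T H phi t) <= C * W (n * t) (m * t))%N
      & (0 < n)%N -> (0 < t)%N ->
          (tspan (fewneg T H phi t) <= C * S (n * t) (m * t))%N].

Section RestrictedSSSP.
Variables (R : realType) (cwhp : R) (Q : nat -> nat) (tau : nat).
Variables (dirldd : dirldd_proc R) (fewneg : fewneg_proc).
Variables (T : finType) (G : graph T).

Let n := nverts G.
Let m := nedges G.

(* [up_log 2 x] is log x rounded up. *)
Definition num_levels : nat := up_log 2 (2 * n ^ 2)%N.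
Definition num_rounds : nat := `|Num.ceil ((2 + cwhp) * log2 R n)|%N.
Definition neg_budget : nat := (4 * Q n + 1)%N.

Definition min_pot (ds : seq (potential T)) : potential T := fun v =>
  if ds is d :: ds' then \big[Num.min/d v]_(d' <- ds') d' v else 0.

Definition solve_block (Phi : seq (potential T)) (H : graph T) :
  prog R (potential T) :=
  ds <-- seq_all [seq det R (fewneg H phi neg_budget) | phi <- Phi] ;;
  _ <-- elementwise R tau (size Phi * nverts H) ;;
  ret R (min_pot ds).

(* [block_index] counts from 0 and the index i in phi^(i)(v) - i n from 1. *)
Definition combine (P : seq {set T}) (phis : seq (potential T)) :
  potential T := fun v =>
  let i := block_index P v in
  nth (fun=> 0) phis i v - (i.+1 * n)%:Z.

Definition ldd_round (G0 : graph T) (Phi : seq (potential T)) (l : nat) :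
  prog R (potential T) :=
  P <-- dirldd G0 (2 ^ l)%N ;;
  _ <-- sorting R tau (n + m) ;;
  phis <-- par_all tau [seq solve_block Phi (induced_subgraph G A) | A : {set T} <- P] ;;
  _ <-- elementwise R tau n ;;
  ret R (combine P phis).

(* For [n = 1] there are no rounds, and the default value of [head] is the
   zero potential. *)
Definition restricted_sssp : prog R (potential T) :=
  _ <-- elementwise R tau (n + m) ;;
  let G0 := nonneg_part G in
  Phi <-- loop (iota 1 num_levels)
            (fun l Phi => seq_all (nseq num_rounds (ldd_round G0 Phi l)))
            [:: fun=> 0] ;;
  ret R (head (fun=> 0) Phi).

End RestrictedSSSP.

(* Main.v *)
Require Import Defs.
From HB Require Import structures.
From mathcomp Require Import all_boot all_order all_algebra.
From mathcomp Require Import all_classical all_reals all_analysis.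
From mathcomp Require Import ring lra zify.

Set Implicit Arguments.
Unset Strict Implicit.
Unset Printing Implicit Defensive.

Import Order.TTheory GRing.Theory Num.Theory.
Import numFieldNormedType.Exports.

Local Open Scope classical_set_scope.
Local Open Scope ring_scope.

(* A walk ending in v that is shortest inside a block of diameter 2^l has weight
   at most 0, and closing it up inside G_{>=0} shows that it has at most 2^l
   edges and nonnegative weight at most 2^l.  Hence an ordered partition of
   parameter 2^(l-1) cuts it 2Q + o(1) times in expectation, at most 4Q + 1
   times with probability at least 1/2 (Markov), and one of N independent
   partitions does so with probability at least 1 - 2^-N.  Shifting the block-wise
   distances by multiples of n makes every uncut edge nonnegative, so this is
   what FewNegSSSP needs to find all distances at the next level.

   The levels are handled by a coupling: in the ideal process the potentials of
   level l are the true block-wise distances of N fresh partitions, independently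
   of the previous level.  The distance in total variation between the real and
   the ideal process grows by at most N n 2^-N per level.  At the last level
   no edge is cut. *)

(** * Walks and distances *)

Section Walks.
Variable T : finType.
Implicit Types (e : rel T) (f : T * T -> int) (G H : graph T) (p q : seq T).

Lemma path_edges_cat u p q :
  path_edges u (p ++ q) = path_edges u p ++ path_edges (last u p) q.
Proof. exact: pairmap_cat. Qed.

Lemma size_path_edges u p : size (path_edges u p) = size p.
Proof. exact: size_pairmap. Qed.

Lemma path_edgesP e u p : path e u p ->
  forall a, a \in path_edges u p -> e a.1 a.2.
Proof.
elim: p u => [//|x p IH] u /= /andP[eux /IH{}IH] a.
by rewrite inE => /orP[/eqP->|/IH].
Qed.

(* Cutting out the cycle through [u], when the walk returns to it, does not
   increase the weight. *)
Lemma walk_shorten e f u p :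
  (forall c, c != [::] -> cycle e c -> uniq c ->
    0 <= \sum_(a <- cycle_edges c) f a) ->
  path e u p ->
  exists q, [/\ path e u q, last u q = last u p, uniq (u :: q) &
    \sum_(a <- path_edges u q) f a <= \sum_(a <- path_edges u p) f a].
Proof.
move=> fcyc; elim: p u => [|x p IH] u; first by move=> _; exists [::].
rewrite [path _ _ _]/= => /andP[eux /IH[q [eq lq uq leq]]].
have [|uNq] := boolP (u \in x :: q); last first.
  by exists (x :: q); split; rewrite ?cons_uniq ?uNq ?uq //= ?eux ?big_cons ?lerD2l.
move=> uq'; have [a [b xqE]] : exists a b, x :: q = rcons a u ++ b.
  by case/splitPr: uq' => a b; exists a, b; rewrite cat_rcons.
have exq : path e u (x :: q) by rewrite /= eux.
exists b; split.
- by move: exq; rewrite xqE cat_path last_rcons => /andP[].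
- by rewrite /= -lq -[last x q]/(last u (x :: q)) xqE last_cat last_rcons.
- by move: uq; rewrite xqE cat_rcons cat_uniq => /and3P[].
- have le2 : \sum_(i <- path_edges u (x :: q)) f i <=
      \sum_(i <- path_edges u (x :: p)) f i.
    by rewrite /= !big_cons lerD2l.
  apply: le_trans le2; rewrite xqE path_edges_cat big_cat last_rcons /= lerDr.
  have := fcyc (u :: a); apply => //.
    by move: exq; rewrite xqE cat_path => /andP[].
  move: uq; rewrite xqE cat_rcons -cat1s catA cat_uniq cats1 => /and3P[].
  by rewrite rcons_uniq.
Qed.

(** Shortening a closed walk leaves a walk from [u] to [u] without repeated vertices. This is the
    empty walk, of weight 0. *)
Lemma closed_walk_ge0 e f u p :
  (forall c, c != [::] -> cycle e c -> uniq c ->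
    0 <= \sum_(a <- cycle_edges c) f a) ->
  path e u p -> last u p = u -> 0 <= \sum_(a <- path_edges u p) f a.
Proof.
move=> fcyc ep lp; have [q [eq lq uq leq]] := walk_shorten fcyc ep.
apply: le_trans leq; case: q {eq} lq uq => [|x q]; first by rewrite big_nil.
by rewrite lp => /= lq; rewrite -{1}lq mem_last.
Qed.

Lemma dipath_walk H u p v : dipath H u p v ->
  [/\ u \in vset H, path (erel H) u p & last u p = v].
Proof. by case/and3P=> ? ? /eqP. Qed.

Lemma eset_vset H a : a \in eset H -> (a.1 \in vset H) && (a.2 \in vset H).
Proof. by move/(fintype.subsetP (eset_sub H)); rewrite finset.inE. Qed.

Lemma path_vset H u p : u \in vset H -> path (erel H) u p ->
  {subset u :: p <= vset H}.
Proof.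
elim: p u => [|x p IH] u uH; first by move=> _ x; rewrite inE => /eqP->.
rewrite [path _ _ _]/= => /andP[/eset_vset/andP[/= _ xH] /(IH _ xH) sub] y.
by rewrite inE => /orP[/eqP->|/sub].
Qed.

Lemma path_edges_eset H u p : path (erel H) u p ->
  {subset path_edges u p <= eset H}.
Proof. by move=> /path_edgesP h [a b] /h. Qed.

Lemma dipath_target H u p v : dipath H u p v -> v \in vset H.
Proof.
by case/dipath_walk=> uH pH <-; apply: (path_vset uH pH); exact: mem_last.
Qed.

Lemma dipath_empty H v : v \in vset H -> dipath H v [::] v.
Proof. by move=> vH; rewrite /dipath vH /=. Qed.

Lemma dipath_rcons H u p v x : dipath H u p v -> (v, x) \in eset H ->
  dipath H u (rcons p x) x.
Proof.
case/dipath_walk=> uH pH lp vx.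
by rewrite /dipath uH rcons_path pH lp last_rcons /= eqxx andbT.
Qed.

Lemma weight_rcons H u p v x : last u p = v ->
  weight H (path_edges u (rcons p x)) =
  weight H (path_edges u p) + wt H (v, x).
Proof.
by move=> <-; rewrite -cats1 /weight path_edges_cat big_cat /= big_seq1.
Qed.

Lemma uniq_walk_size H u p : u \in vset H -> path (erel H) u p ->
  uniq (u :: p) -> (size p < nverts H)%N.
Proof.
move=> uH pH upu; rewrite -[(size p).+1]/(size (u :: p)) -(card_uniqP upu).
by apply: subset_leq_card; apply/fintype.subsetP; exact: path_vset.
Qed.

Lemma weight_ge (H : graph T) (es : seq (T * T)) :
  (forall a, a \in eset H -> -1 <= wt H a) -> {subset es <= eset H} ->
  - (size es)%:Z <= weight H es.
Proof.
move=> wH; elim: es => [|a es IH] sub; first by rewrite /weight big_nil.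
have wa := wH a (sub _ (mem_head _ _)).
have := IH (fun x xs => sub x (@mem_behead _ (a :: es) x xs)).
rewrite /weight big_cons /=; lia.
Qed.

Lemma no_negative_cycle_sum H : no_negative_cycle H ->
  forall c, c != [::] -> cycle (erel H) c -> uniq c ->
    0 <= \sum_(a <- cycle_edges c) wt H a.
Proof. by move=> nH c c0 cc uc; apply: nH; rewrite /dicycle c0 cc uc. Qed.

(** The shortened walk has fewer than n edges, each of weight at least -1. The strictness of the
    bound matters in [uncut_nonneg]. *)
Lemma walk_weight_lb H u p v :
  no_negative_cycle H -> (forall a, a \in eset H -> -1 <= wt H a) ->
  dipath H u p v -> - (nverts H)%:Z < weight H (path_edges u p).
Proof.
move=> nH wH /dipath_walk[uH pH lp].
have [q [qH lq uq leq]] := walk_shorten (no_negative_cycle_sum nH) pH.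
have := weight_ge wH (path_edges_eset qH).
have := uniq_walk_size uH qH uq; rewrite size_path_edges /weight.
move: leq; lia.
Qed.

(** The pair holds the start and the remaining vertices. The start is free, as in the distance from
    the whole vertex set to [v]. *)
Definition optimal_walk H v (x : T * seq T) : Prop :=
  dipath H x.1 x.2 v /\ forall u p, dipath H u p v ->
    weight H (path_edges x.1 x.2) <= weight H (path_edges u p).

(** There may be infinitely many walks, but their weights exceed -n. After a shift by n they are
    natural numbers, among which a least one exists. *)
Lemma optimal_walk_exists H v :
  no_negative_cycle H -> (forall a, a \in eset H -> -1 <= wt H a) ->
  v \in vset H -> exists x, optimal_walk H v x.
Proof.
move=> nH wH vH.
pose P k := `[< exists x : T * seq T, dipath H x.1 x.2 v /\
  weight H (path_edges x.1 x.2) + (nverts H)%:Z = k%:Z >].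
have Pw u p : dipath H u p v ->
    P (absz (weight H (path_edges u p) + (nverts H)%:Z)).
  move=> uv; apply/asboolP; exists (u, p); split=> //=.
  by have := walk_weight_lb nH wH uv; lia.
have exP : exists k, P k by eexists; exact: Pw (dipath_empty vH).
case: (ex_minnP exP) => k /asboolP[x [xv wx]] kmin.
exists x; split=> // u p uv; have := kmin _ (Pw _ _ uv).
by have := walk_weight_lb nH wH uv; lia.
Qed.

(** Fixing one optimal walk per vertex lets the later union bound range over vertices and not over
    walks. *)
Definition opt_walk H v : T * seq T :=
  xget (v, [::]) [set x | optimal_walk H v x].

Definition mindist H v : int :=
  weight H (path_edges (opt_walk H v).1 (opt_walk H v).2).

Lemma opt_walkP H v :
  no_negative_cycle H -> (forall a, a \in eset H -> -1 <= wt H a) ->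
  v \in vset H -> optimal_walk H v (opt_walk H v).
Proof.
move=> nH wH vH; rewrite /opt_walk; case: xgetP => // /(_ _)/= none.
by have [x] := optimal_walk_exists nH wH vH; move/(none x).
Qed.

Section Distances.
Variable R : realType.

(** Weights are integers: if no walk had weight at most [z], all of them would weigh at least
    [z + 1], and so would the infimum. *)
Lemma dist_le_walk H u v (z : int) :
  (dist R H u v <= z%:~R%:E)%E ->
  exists2 p, dipath H u p v & weight H (path_edges u p) <= z.
Proof.
move=> dz; apply: contrapT => none.
suff: ((z + 1)%:~R%:E <= dist R H u v)%E.
  move/le_trans => /(_ _ dz); rewrite lee_fin ler_int; lia.
apply: le_ereal_inf_tmp => _ [p /= uv <-]; rewrite lee_fin ler_int.
by rewrite leNgt; apply/negP => lt; apply: none; exists p => //; lia.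
Qed.

Lemma walk_dist_le H u v p : dipath H u p v ->
  (dist R H u v <= (weight H (path_edges u p))%:~R%:E)%E.
Proof. by move=> uv; apply: ereal_inf_lbound; exists p. Qed.

Lemma dist_from_le_walk H (S : {set T}) v (z : int) :
  (dist_from R H S v <= z%:~R%:E)%E ->
  exists u p, dipath H u p v /\ weight H (path_edges u p) <= z.
Proof.
move=> dz; apply: contrapT => none.
suff: ((z%:~R : R)%:E < dist_from R H S v)%E by rewrite ltNge dz.
rewrite /dist_from; elim/big_ind: _ => [|x y zx zy|u _].
- exact: ltry.
- by rewrite lt_min zx.
- rewrite ltNge; apply/negP => /dist_le_walk[p uv lew].
  by apply: none; exists u, p.
Qed.

End Distances.
End Walks.

(** * Expected values of randomized programs *)

Section ExpectedValue.
Variable R : realType.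
Implicit Types A B : Type.

(** This is the expectation of [g] on the result alone. Forgetting the costs turns sequential
    composition into nested expectations, and two programs have the same output law when all their
    [valE] agree. *)
Definition valE A (c : prog R A) (g : A -> R) : R :=
  \sum_s prob s * g (tvalue (run (r := c) s)).

Lemma valE_det A (a : timed A) g : valE (det R a) g = g (tvalue a).
Proof.
by rewrite /valE (big_pred1 tt) ?mul1r // => -[]; rewrite eqxx.
Qed.

Lemma eq_valE A (c : prog R A) g h : g =1 h -> valE c g = valE c h.
Proof. by move=> gh; apply: eq_bigr => s _; rewrite gh. Qed.

Lemma valE_seqc A B (c : prog R A) (f : A -> prog R B) g :
  valE (seqc c f) g = valE c (fun a => valE (f a) g).
Proof.
rewrite /valE.
under [RHS]eq_bigr do rewrite big_distrr /=.
rewrite (@sig_big_dep _ _ _ _ _ predT (fun _ => predT)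
  (fun (i : seed c) (j : seed (f (tvalue (run i)))) =>
     prob i * (prob j * g (tvalue (run j))))) /=.
by apply: eq_bigr => s _; rewrite mulrA.
Qed.

Lemma valE_join_cons A (c : prog R A) cs g :
  valE (join_all (c :: cs)) g =
  valE c (fun a => valE (join_all cs) (fun l => g (a :: l))).
Proof.
rewrite /valE.
under [RHS]eq_bigr do rewrite big_distrr /=.
rewrite (@sig_big_dep _ _ _ _ _ predT (fun _ => predT)
  (fun (i : seed c) (j : seed (join_all cs)) =>
     prob i * (prob j * g (tvalue (run i) :: tvalue (run j))))) /=.
by apply: eq_bigr => s _; rewrite mulrA.
Qed.

Lemma valE_seq_all_cons A (c : prog R A) cs g :
  valE (seq_all (c :: cs)) g =
  valE c (fun a => valE (seq_all cs) (fun l => g (a :: l))).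
Proof.
rewrite valE_seqc; apply: eq_valE => a.
by rewrite valE_seqc; apply: eq_valE => l; rewrite valE_det.
Qed.

Lemma valE_par_all A tau (cs : seq (prog R A)) g :
  valE (par_all tau cs) g = valE (join_all cs) g.
Proof. by rewrite valE_seqc valE_det. Qed.

Lemma valE_loop_rcons A I (s : seq I) i (f : I -> A -> prog R A) a g :
  valE (loop (rcons s i) f a) g =
  valE (loop s f a) (fun b => valE (f i b) g).
Proof.
elim: s a => [|j s IH] a /=; last by rewrite !valE_seqc; apply: eq_valE.
by rewrite valE_seqc valE_det; apply: eq_valE => b; rewrite valE_det.
Qed.

Lemma valE_cst A (c : prog R A) (x : R) : valE c (fun=> x) = x.
Proof. by rewrite /valE -big_distrl /= prob_sum1 mul1r. Qed.

Lemma valED A (c : prog R A) g h :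
  valE c (fun a => g a + h a) = valE c g + valE c h.
Proof. by rewrite -big_split /=; apply: eq_bigr => s _; rewrite mulrDr. Qed.

Lemma valEZ A (c : prog R A) (x : R) g :
  valE c (fun a => x * g a) = x * valE c g.
Proof. by rewrite big_distrr /=; apply: eq_bigr => s _; rewrite mulrCA. Qed.

Lemma valE_sum A I (r : seq I) (P : pred I) (c : prog R A) (g : I -> A -> R) :
  valE c (fun a => \sum_(i <- r | P i) g i a) =
  \sum_(i <- r | P i) valE c (g i).
Proof.
by rewrite exchange_big /=; apply: eq_bigr => s _; rewrite big_distrr.
Qed.

Lemma valE_exchange A B (c : prog R A) (d : prog R B) (g : A -> B -> R) :
  valE c (fun a => valE d (g a)) = valE d (fun b => valE c (g^~ b)).
Proof.
rewrite [RHS]/valE; under [RHS]eq_bigr do rewrite -valEZ.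
by rewrite -valE_sum.
Qed.

Lemma le_valE_always A (c : prog R A) (P : A -> Prop) g h :
  always c (fun o => P (tvalue o)) -> (forall a, P a -> g a <= h a) ->
  valE c g <= valE c h.
Proof.
move=> cP gh; apply: ler_sum => s _; rewrite ler_wpM2l //.
  exact/ltW/prob_gt0.
by apply: gh; exact: cP.
Qed.

Lemma le_valE A (c : prog R A) g h :
  (forall a, g a <= h a) -> valE c g <= valE c h.
Proof. by move=> gh; apply: (@le_valE_always _ _ xpredT). Qed.

Lemma valE_ge0 A (c : prog R A) g : (forall a, 0 <= g a) -> 0 <= valE c g.
Proof. by move=> g0; rewrite -(valE_cst c 0) le_valE. Qed.

Lemma valE_le1 A (c : prog R A) g : (forall a, g a <= 1) -> valE c g <= 1.
Proof. by move=> g1; rewrite -[leRHS](valE_cst c 1) le_valE. Qed.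

Lemma Pr_valE A (c : prog R A) (E : pred A) :
  Pr c (fun o => E (tvalue o)) = valE c (fun a => (E a)%:R).
Proof.
rewrite /Pr big_mkcond; apply: eq_bigr => s _.
by case: (E _); rewrite ?mulr1 ?mulr0.
Qed.

Lemma Pr_lbound A (c : prog R A) (E : pred A) (x : R) :
  valE c (fun a => (~~ E a)%:R) <= x -> 1 - x <= Pr c (fun o => E (tvalue o)).
Proof.
rewrite Pr_valE lerBlDr => cx; apply: le_trans (lerD (lexx _) cx).
rewrite -valED -[leLHS](valE_cst c); apply: le_valE => a.
by case: (E a); rewrite ?addr0 ?add0r.
Qed.

(** Markov's inequality; since [X] takes natural values, exceeding [t] means reaching [t.+1]. *)
Lemma valE_markov A (c : prog R A) (X : A -> nat) (t : nat) (b : R) :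
  valE c (fun a => (X a)%:R) <= b * t.+1%:R ->
  valE c (fun a => (t < X a)%N%:R) <= b.
Proof.
move=> cb; rewrite -(@ler_pM2r _ t.+1%:R) //; apply: le_trans cb.
rewrite mulrC -valEZ; apply: le_valE => a.
by case: ltnP => tX; rewrite ?mulr1 ?mulr0 // ler_nat.
Qed.

Section IndependentCopies.
Variables (A B : Type) (c : prog R A).

(** The hypothesis says that [d] has the law of [k] applied to the result of [c]; this carries over
    to independent copies. *)
Lemma valE_nseq_map (d : prog R B) (k : A -> B) N (g : seq B -> R) :
  (forall h, valE d h = valE c (h \o k)) ->
  valE (seq_all (nseq N d)) g = valE (seq_all (nseq N c)) (g \o map k).
Proof.
move=> dc; elim: N g => [|N IH] g; first by rewrite !valE_det.
rewrite !valE_seq_all_cons dc; apply: eq_valE => a /=.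
by rewrite IH.
Qed.

(** Union bound over the copies. *)
Lemma valE_nseq_has (p : pred A) N :
  valE (seq_all (nseq N c)) (fun l => (has p l)%:R) <=
  N%:R * valE c (fun a => (p a)%:R).
Proof.
elim: N => [|N IH]; first by rewrite valE_det mul0r.
rewrite valE_seq_all_cons -natr1 mulrDl mul1r addrC.
apply: (@le_trans _ _ (valE c (fun a => (p a)%:R +
    valE (seq_all (nseq N c)) (fun l => (has p l)%:R)))); last first.
  by rewrite valED valE_cst lerD2l.
apply: le_valE => a; rewrite -[X in X + _](valE_cst (seq_all (nseq N c))) -valED.
by apply: le_valE => l /=; case: (p a); case: (has p l); rewrite /= ?addr0 ?add0r ?lerDl.
Qed.

(** Independence of the copies. *)
Lemma valE_nseq_all (p : pred A) N :
  valE (seq_all (nseq N c)) (fun l => (all p l)%:R) =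
  valE c (fun a => (p a)%:R) ^+ N.
Proof.
elim: N => [|N IH]; first by rewrite valE_det expr0.
rewrite valE_seq_all_cons exprSr -IH -valEZ; apply: eq_valE => a /=.
rewrite [RHS]mulrC -valEZ; apply: eq_valE => l.
by case: (p a); rewrite ?mul1r ?mul0r.
Qed.

End IndependentCopies.

Lemma always_seqc A B (c : prog R A) (f : A -> prog R B) P :
  always c (fun a => always (f (tvalue a)) (fun b =>
    P (Timed (tvalue b) (twork a + twork b) (tspan a + tspan b)))) ->
  always (seqc c f) P.
Proof. by move=> cP [s1 s2]; exact: cP. Qed.

End ExpectedValue.

Section Values.
Variables (R : realType) (A : Type).

Lemma valE_seq_all_map I (s : seq I) (c : I -> prog R A) (k : I -> A) g :
  (forall i h, valE (c i) h = h (k i)) ->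
  valE (seq_all [seq c i | i <- s]) g = g [seq k i | i <- s].
Proof.
move=> ck; elim: s g => [|i s IH] g; first by rewrite valE_det.
by rewrite [map _ _]/= valE_seq_all_cons ck IH.
Qed.

Lemma valE_join_all_map I (s : seq I) (c : I -> prog R A) (k : I -> A) g :
  (forall i h, valE (c i) h = h (k i)) ->
  valE (join_all [seq c i | i <- s]) g = g [seq k i | i <- s].
Proof.
move=> ck; elim: s g => [|i s IH] g; first by rewrite valE_det.
by rewrite [map _ _]/= valE_join_cons ck IH.
Qed.

End Values.

(** * Block-wise distances in restricted graphs *)

Section MinPot.
Variable T : finType.
Implicit Types (ds : seq (potential T)) (v : T) (z : int).

Lemma min_pot_le ds v z : has (fun d => d v <= z) ds -> min_pot ds v <= z.
Proof.
case: ds => //= d ds; elim: ds => [|d' ds IH]; first by rewrite big_nil orbF.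
rewrite big_cons ge_min /= => /or3P[dz|->//|hz]; rewrite IH ?orbT //.
  by rewrite dz.
by rewrite hz orbT.
Qed.

Lemma min_pot_ge ds v z : (0 < size ds)%N ->
  all (fun d => z <= d v) ds -> z <= min_pot ds v.
Proof.
case: ds => //= d ds _ /andP[zd]; elim: ds => [|d' ds IH]; first by rewrite big_nil.
by rewrite big_cons le_min /= => /andP[-> /IH].
Qed.

End MinPot.

(** * Ordered partitions and their blocks *)

Section Partitions.
Variables (T : finType) (D : {set T}) (P : seq {set T}).
Hypothesis partP : ordered_partition P D.
Implicit Types (v : T) (A : {set T}).

Definition block v : {set T} := nth finset.set0 P (block_index P v).

Let partP' : finset.partition [set:: P] D. Proof. by case/andP: partP. Qed.

Lemma has_block v : v \in D -> has (fun A : {set T} => v \in A) P.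
Proof.
rewrite -(cover_partition partP') => /finset.bigcupP[A].
by rewrite finset.inE => AP vA; apply/hasP; exists A.
Qed.

Lemma block_index_lt v : v \in D -> (block_index P v < size P)%N.
Proof. by move=> /has_block; rewrite has_find. Qed.

Lemma mem_block v : v \in D -> v \in block v.
Proof. by move=> /has_block /(nth_find finset.set0). Qed.

Lemma block_mem v : v \in D -> block v \in P.
Proof. by move=> vD; rewrite mem_nth ?block_index_lt. Qed.

Lemma part_sub A v : A \in P -> v \in A -> v \in D.
Proof.
move=> AP vA; rewrite -(cover_partition partP').
by apply/finset.bigcupP; exists A; rewrite ?finset.inE.
Qed.

Lemma part_neq0 A : A \in P -> A != finset.set0.
Proof.
move=> AP; case/and3P: partP' => _ _; apply: contraNneq => <-.
by rewrite finset.inE.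
Qed.

(** Disjointness is known for the set [[set:: P]], which forgets multiplicities; that no block is
    listed twice comes from [uniq P]. *)
Lemma part_count v : (count (fun A : {set T} => v \in A) P <= 1)%N.
Proof.
case/andP: partP => uP _; case/and3P: partP' => _ /finset.trivIsetP tP _.
have sameP A B : A \in P -> B \in P -> v \in A -> v \in B -> A = B.
  move=> AP BP vA vB; apply/eqP; apply: contraTT isT => AB.
  have := tP A B; rewrite !finset.inE => /(_ AP BP AB)/pred0P/(_ v) /=.
  by rewrite vA vB.
rewrite -size_filter.
case E: (seq.filter _ P) => [//|A [//|B s]].
have uf := filter_uniq (fun A : {set T} => v \in A) uP.
have mf C : C \in seq.filter (fun A : {set T} => v \in A) P -> (C \in P) && (v \in C).
  by rewrite mem_filter andbC.
rewrite E in uf mf.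
have /andP[AP vA] := mf A (mem_head _ _).
have /andP[BP vB] : (B \in P) && (v \in B) by apply: mf; rewrite !inE eqxx orbT.
by move: uf; rewrite (sameP A B) //= inE eqxx.
Qed.

Lemma size_part : (size P <= #|D|)%N.
Proof.
case/andP: partP => uP _; rewrite (card_partition partP').
have <- : \sum_(A <- P) #|A| = (\sum_(A in [set:: P]) #|A|)%N.
  by rewrite big_uniq //=; apply: eq_bigl => A; rewrite finset.inE.
rewrite -sum1_size !big_seq; apply: leq_sum => A AP.
by rewrite finset.card_gt0 part_neq0.
Qed.

(** Double counting: an element [e] lies in [B A] only for the block [A] that contains [f e]. The
    uses are vertices with [f] the identity and edges with [f] the source. *)
Lemma sum_card_part (U : finType) (E : {set U}) (f : U -> T) (B : {set T} -> {set U}) :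
  (forall A e, e \in B A -> (e \in E) && (f e \in A)) ->
  (\sum_(A <- P) #|B A| <= #|E|)%N.
Proof.
move=> BE; under eq_bigr do rewrite -sum1_card big_mkcond.
rewrite exchange_big /= -sum1_card [leqRHS]big_mkcond /=; apply: leq_sum => e _.
rewrite -big_mkcond sum1_count /=; case: ifPn => eE; last first.
  rewrite (eq_count (a2 := pred0)) ?count_pred0 // => A /=.
  by apply: contraNF eE => /BE/andP[].
apply: leq_trans (part_count (f e)); apply: sub_count => A /BE.
by case/andP.
Qed.

End Partitions.

(** * Shortest walks inside blocks, and the potentials they define *)

Section RestrictedGraph.
Variables (T : finType) (G : graph T).
Hypothesis rG : restricted G.
Implicit Types (u v : T) (p : seq T) (S : {set T}) (es : seq (T * T)).

Lemma restricted_wt a : a \in eset G -> -1 <= wt G a.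
Proof. by move=> aG; case: rG => /(_ a aG)/andP[]. Qed.

Lemma induced_wt S a : a \in eset (induced_subgraph G S) ->
  -1 <= wt (induced_subgraph G S) a.
Proof. by rewrite finset.inE => /andP[/restricted_wt]. Qed.

Lemma induced_path S u p :
  path (erel (induced_subgraph G S)) u p -> path (erel G) u p.
Proof. by apply: sub_path => x y; rewrite /erel /= finset.inE => /andP[]. Qed.

Lemma induced_nonneg_cycle S : no_negative_cycle (induced_subgraph G S).
Proof.
move=> c /and3P[c0 cc uc]; case: rG => _ rc.
have: dicycle G c.
  rewrite /dicycle c0 uc andbT /=; apply: sub_cycle cc => x y.
  by rewrite /erel /= finset.inE => /andP[].
by move/rc; apply: le_trans.
Qed.

Lemma size_cycle_edges (c : seq T) : size (cycle_edges c) = size c.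
Proof. by case: c => //= x p; rewrite size_path_edges size_rcons. Qed.

Lemma sum_wt_sub1 es : \sum_(a <- es) (wt G a - 1) = weight G es - (size es)%:Z.
Proof.
rewrite big_split /= sumrN; congr (_ - _).
by rewrite big_const_seq count_predT iter_addr_0 natz.
Qed.

(** Being restricted on cycles means having no negative cycle for the weights w - 1, so
    [closed_walk_ge0] applies to these. *)
Lemma closed_walk_weight u p : path (erel G) u p -> last u p = u ->
  (size p)%:Z <= weight G (path_edges u p).
Proof.
move=> pG lp; rewrite -subr_ge0 -(size_path_edges u p) -sum_wt_sub1.
apply: closed_walk_ge0 pG lp => c c0 cc uc.
by rewrite sum_wt_sub1 size_cycle_edges subr_ge0; case: rG => _; apply; apply/and3P.
Qed.

(** These are the properties of a shortest walk in a block of diameter [d] that no longer mention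
    the block. The last two conditions together give at most [d] edges. *)
Definition walk_bound (d : nat) u p : Prop :=
  [/\ u \in vset G, path (erel G) u p, weight G (path_edges u p) <= 0 &
      (size p)%:Z <= weight G (path_edges u p) + d%:Z].

(** Since w >= -1, replacing w by max(0, w) costs at most 1 per edge. *)
Lemma nonneg_part_le es : {subset es <= eset G} ->
  weight (nonneg_part G) es <= weight G es + (size es)%:Z.
Proof.
elim: es => [|a es IH] sub; first by rewrite /weight !big_nil.
have := IH (fun x xs => sub x (@mem_behead _ (a :: es) x xs)).
have := restricted_wt (sub _ (mem_head _ _)).
rewrite /weight !big_cons /=; lia.
Qed.

Lemma nonneg_part_ge es : weight G es <= weight (nonneg_part G) es.
Proof. by apply: ler_sum => a _; rewrite /= le_max lexx orbT. Qed.

Lemma walk_bound_nonneg d u p : walk_bound d u p ->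
  weight (nonneg_part G) (path_edges u p) <= d%:Z.
Proof.
case=> uG pG w0 wd; have := nonneg_part_le (path_edges_eset pG).
rewrite size_path_edges; lia.
Qed.

Lemma walk_bound_size d u p : walk_bound d u p -> (size p <= d)%N.
Proof. by case=> _ _; lia. Qed.

(** Such a walk has at most two edges. Two negative ones would have total weight at most -2,
    contradicting 2 <= weight + 2. Hence the zero potential serves as the start of the induction. *)
Lemma neg_count0 u p : walk_bound 2 u p ->
  (neg_count G (fun=> 0) (path_edges u p) <= 1)%N.
Proof.
move=> wb; have := walk_bound_size wb; case: wb => _ _.
rewrite /neg_count /wt_pot; case: p => [//|x [|y [|z p]]] //.
  by move=> *; apply: leq_trans (count_size _ _) _.
rewrite /weight /= !big_cons big_nil !(addr0, subr0) => _.
case: (ltrP (wt G (u, x)) 0); case: (ltrP (wt G (x, y)) 0) => //=; lia.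
Qed.

Section Partition.
Variable P : seq {set T}.
Hypothesis partP : ordered_partition P (vset G).

Definition block_graph v := induced_subgraph G (block P v).

Definition block_walk v := opt_walk (block_graph v) v.

Lemma vset_block_graph v : v \in vset G -> v \in vset (block_graph v).
Proof. by move=> vG; rewrite finset.inE vG (mem_block partP). Qed.

Lemma block_walkP v : v \in vset G ->
  optimal_walk (block_graph v) v (block_walk v).
Proof.
move=> vG; apply: opt_walkP (vset_block_graph vG).
- exact: induced_nonneg_cycle.
- exact: induced_wt.
Qed.

Lemma mindist_le u p v : dipath (block_graph v) u p v ->
  mindist (block_graph v) v <= weight G (path_edges u p).
Proof.
move=> uv; have := dipath_target uv; rewrite finset.inE => /andP[vG _].
by have [_ /(_ _ _ uv)] := block_walkP vG.
Qed.

Lemma mindist_le0 v : v \in vset G -> mindist (block_graph v) v <= 0.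
Proof.
move=> vG; apply: le_trans (mindist_le (dipath_empty (vset_block_graph vG))) _.
by rewrite /weight big_nil.
Qed.

Lemma mindist_lb v : v \in vset G ->
  - (nverts G)%:Z < mindist (block_graph v) v.
Proof.
move=> vG; have [xv _] := block_walkP vG.
have := @walk_weight_lb _ (block_graph v) _ _ _
  (@induced_nonneg_cycle _) (@induced_wt _) xv.
have : (nverts (block_graph v) <= nverts G)%N.
  by apply: subset_leq_card; exact: finset.subsetIl.
rewrite /mindist -/(block_walk v). lia.
Qed.

(* Closing the walk by a path of weight at most [d] yields a closed walk, whose
   weight is at least its number of edges. *)
Lemma block_walk_bound (R : realType) (d : nat) v : v \in vset G ->
  (forall A, A \in P -> forall x y, x \in A -> y \in A ->
    (dist R (nonneg_part G) x y <= d%:R%:E)%E) ->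
  walk_bound d (block_walk v).1 (block_walk v).2.
Proof.
move=> vG diam; have [xv _] := block_walkP vG.
have := mindist_le0 vG; rewrite /mindist -/(block_walk v).
case: (block_walk v) xv => u p /= /dipath_walk[].
rewrite finset.inE => /andP[uG ub] pH lp w0.
have := diam _ (block_mem partP vG) _ _ (mem_block partP vG) ub.
rewrite pmulrn => /dist_le_walk[q /dipath_walk[_ qG lq] wq].
have pG := induced_path pH.
split=> //; have qG' : path (erel G) v q by [].
have := @closed_walk_weight u (p ++ q).
rewrite cat_path lp pG qG' last_cat lp lq path_edges_cat size_cat lp => /(_ isT erefl).
rewrite {1}/weight big_cat /= -!/(weight _ _).
have := nonneg_part_ge (path_edges v q); move: w0 wq; rewrite /weight /=; lia.
Qed.

(** The value 0 off the blocks copies the default of [nth] in [combine], so that [round_pot_exact]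
    can be an equality of functions. *)
Definition exactpot : potential T := fun v =>
  (if (block_index P v < size P)%N then mindist (block_graph v) v else 0)
  - ((block_index P v).+1 * nverts G)%:Z.

Lemma exactpotE v : v \in vset G -> exactpot v =
  mindist (block_graph v) v - ((block_index P v).+1 * nverts G)%:Z.
Proof. by move=> vG; rewrite /exactpot (block_index_lt partP vG). Qed.

(** Inside a block this is the triangle inequality for distances. From a block to a later one the
    shift gains at least n, while the distance at the source is at least 1 - n, the edge weighs at
    least -1 and the distance at the target is at most 0. *)
Lemma uncut_nonneg a : a \in eset G -> ~~ is_cut P a ->
  0 <= wt_pot G exactpot a.
Proof.
case: a => x y xyG; have /andP[/= xG yG] := eset_vset xyG.
rewrite /is_cut /wt_pot /= -leqNgt leq_eqVlt !exactpotE // => /orP[/eqP eqi|lti].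
  have eqb : block_graph x = block_graph y by rewrite /block_graph /block eqi.
  have [xv _] := block_walkP xG.
  have xyH : (x, y) \in eset (block_graph x).
    by rewrite !finset.inE xyG /= (mem_block partP) //= /block eqi (mem_block partP).
  have := dipath_rcons xv xyH; rewrite {1}eqb => /mindist_le.
  case/dipath_walk: xv => _ _ /(weight_rcons G) ->.
  rewrite eqi /mindist -/(block_walk x) -/(block_walk y) /weight /=; lia.
have := restricted_wt xyG; have := mindist_lb xG; have := mindist_le0 yG.
nia.
Qed.

Lemma neg_count_cut es : {subset es <= eset G} ->
  (neg_count G exactpot es <= count (is_cut P) es)%N.
Proof.
elim: es => [//|a es IH] sub.
have {}IH := IH (fun x xs => sub x (@mem_behead _ (a :: es) x xs)).
rewrite /neg_count /= leq_add //; case: ltrP => //= neg.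
case cut: (is_cut P a) => //.
by move: neg; rewrite ltNge uncut_nonneg ?cut // sub ?mem_head.
Qed.

End Partition.

Section Round.
Variables (R : realType) (W S : nat -> nat -> nat) (Q : nat -> nat).
Variable fewneg : fewneg_proc.
Hypothesis Hfewneg : fewneg_spec R W S fewneg.

Let t := neg_budget Q G.

Definition round_pot (Phi : seq (potential T)) (P : seq {set T}) : potential T :=
  combine G P [seq min_pot [seq tvalue (fewneg (induced_subgraph G A) phi t)
                           | phi <- Phi] | A : {set T} <- P].

(** No output of FewNegSSSP lies below the true distance, so neither does the minimum. One potential
    with few negative edges on the fixed optimal walk brings it down to that distance. The good
    potential may differ from vertex to vertex. *)
Lemma round_pot_exact Phi P : ordered_partition P (vset G) ->
  (forall v, v \in vset G ->
    has (fun phi => (neg_count G phi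
      (path_edges (block_walk P v).1 (block_walk P v).2) <= t)%N) Phi) ->
  round_pot Phi P = exactpot P.
Proof.
move=> partP few; apply/funext => v; rewrite /round_pot /combine /exactpot.
congr (_ - _); case: ifPn => [lti|]; last first.
  by rewrite -leqNgt => geP; rewrite nth_default // size_map.
rewrite (nth_map finset.set0) // -/(block P v) -/(block_graph P v).
have vb : v \in block P v.
  by apply: (nth_find finset.set0 (a := fun A : {set T} => v \in A)); rewrite has_find.
have vG : v \in vset G by apply: (part_sub partP _ vb); rewrite mem_nth.
have [C /(_ _ (block_graph P v))HC] := Hfewneg.
have {}HC phi := HC phi t (@induced_nonneg_cycle _).
have {}few := few v vG.
have [xv xopt] := block_walkP partP vG.
apply/eqP; rewrite eq_le; apply/andP; split.
  apply: min_pot_le; rewrite has_map; apply: sub_has few => phi /= few.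
  by have [_ /(_ _ _ _ xv few)] := HC phi.
apply: min_pot_ge; first by rewrite size_map; case: Phi few.
rewrite all_map (eq_all (a2 := predT)) ?all_predT // => phi /=.
have [/(_ _ (vset_block_graph partP vG)) ledv _ _ _] := HC phi.
have [u [p [uv {}ledv]]] := dist_from_le_walk ledv.
by apply: le_trans ledv; apply: mindist_le partP _ _ _ uv.
Qed.

End Round.
End RestrictedGraph.

(** * The coupling *)

Section Coupling.
Variables (R : realType) (W S : nat -> nat -> nat) (Q : nat -> nat).
Variables (cwhp : R) (tau : nat) (dirldd : dirldd_proc R) (fewneg : fewneg_proc).
Hypothesis Hfewneg : fewneg_spec R W S fewneg.
Variables (T : finType) (G : graph T).
Hypothesis rG : restricted G.

Let n := nverts G.
Let G0 := nonneg_part G.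
Let t := neg_budget Q G.
Let N := num_rounds cwhp G.
Let L := num_levels G.
Let ldd l := dirldd G0 (2 ^ l)%N.

Variable K : R.
Hypothesis K_ge0 : 0 <= K.
Hypothesis K_small : (2 ^ L)%:R * (K / n%:R ^+ 8) <= 2^-1.

Hypothesis ldd_part : forall l,
  always (ldd l) (fun o => ordered_partition (tvalue o) (vset G)).
Hypothesis ldd_diam : forall l, always (ldd l) (fun o =>
  forall A : {set T}, A \in tvalue o -> forall u v, u \in A -> v \in A ->
    (dist R G0 u v <= (2 ^ l)%N%:R%:E)%E).
Hypothesis ldd_cut : forall l e, e \in eset G ->
  Pr (ldd l) (fun o => is_cut (tvalue o) e) <=
  (Q n)%:R * (wt G0 e)%:~R / (2 ^ l)%N%:R + K / n%:R ^+ 8.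
Hypothesis ldd_uncut : always (ldd L) (fun o =>
  forall e, e \in eset G -> ~~ is_cut (tvalue o) e).

Local Notation round_pot := (round_pot G Q fewneg).
Local Notation exactpot := (exactpot G).
Local Notation round := (ldd_round Q tau dirldd fewneg G G0).

Lemma valE_solve_block Phi H g :
  valE (solve_block R Q tau fewneg G Phi H) g =
  g (min_pot [seq tvalue (fewneg H phi t) | phi <- Phi]).
Proof.
rewrite valE_seqc.
rewrite (@valE_seq_all_map _ _ _ _ _ (fun phi => tvalue (fewneg H phi t))); last first.
  by move=> phi h; rewrite valE_det.
by rewrite valE_seqc !valE_det.
Qed.

(** After the partition is drawn everything is deterministic, so a round has the law of a function
    of the partition. *)
Lemma valE_round Phi l g :
  valE (round Phi l) g = valE (ldd l) (g \o round_pot Phi).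
Proof.
rewrite valE_seqc; apply: eq_valE => P.
rewrite valE_seqc valE_det valE_seqc valE_par_all.
rewrite (@valE_join_all_map _ _ _ _ _ (fun A : {set T} =>
  min_pot [seq tvalue (fewneg (induced_subgraph G A) phi t) | phi <- Phi])).
  by rewrite valE_seqc !valE_det.
by move=> A h; rewrite valE_solve_block.
Qed.

Definition ideal (l : nat) : prog R (seq (potential T)) :=
  if l is 0 then ret R [:: fun=> 0]
  else seq_all (nseq N (seqc (ldd l) (fun P => ret R (exactpot P)))).

Lemma valE_ideal l g :
  valE (ideal l.+1) g =
  valE (seq_all (nseq N (ldd l.+1))) (fun Ps => g (map exactpot Ps)).
Proof.
apply: (@valE_nseq_map _ _ _ _ _ exactpot) => h.
by rewrite valE_seqc; apply: eq_valE => P; rewrite valE_det.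
Qed.

(** The bad event for one walk: FewNegSSSP gives no upper bound by this walk from any potential of
    [Phi]. *)
Definition all_over (u : T) (p : seq T) (Phi : seq (potential T)) : bool :=
  all (fun phi => t < neg_count G phi (path_edges u p))%N Phi.

(** The nonnegative weight of the walk is at most 2^(l+1), which at parameter 2^l contributes 2Q.
    The walk has at most 2^L edges, so by [K_small] the additive errors contribute at most 1/2. *)
Lemma expected_cuts l u p : (l < L)%N ->
  walk_bound G (2 ^ l.+1) u p ->
  valE (ldd l) (fun P => (count (is_cut P) (path_edges u p))%:R)
    <= (2 * Q n)%:R + 2^-1.
Proof.
move=> lL wb; have [uG pG _ _] := wb.
under eq_valE => P do rewrite -sum1_count natr_sum big_mkcond /=.
rewrite valE_sum.
apply: (@le_trans _ _ (\sum_(e <- path_edges u p)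
   ((Q n)%:R / (2 ^ l)%N%:R * (wt G0 e)%:~R + K / n%:R ^+ 8))).
  rewrite big_seq [leRHS]big_seq; apply: ler_sum => e /(path_edges_eset pG) eG.
  have := ldd_cut l eG.
  rewrite (@Pr_valE _ _ _ (fun P : seq {set T} => is_cut P e)) mulrAC.
  apply: le_trans.
  by apply: le_valE => P; case: ifP.
rewrite big_split /= -big_distrr /= lerD //; last first.
  rewrite big_const_seq count_predT iter_addr_0 size_path_edges -[leLHS]mulr_natl.
  apply: le_trans K_small; rewrite ler_wpM2r ?divr_ge0 ?exprn_ge0 //.
  rewrite ler_nat; apply: leq_trans (walk_bound_size wb) _.
  by rewrite leq_exp2l.
have := walk_bound_nonneg rG wb; rewrite -(ler_int R) -raddf_sum /=.
have p2 : 0 < (2 ^ l)%N%:R :> R by rewrite ltr0n expn_gt0.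
move=> wle; rewrite -mulrA natrM [2%:R * _]mulrC ler_wpM2l // ler_pdivrMl //.
apply: le_trans wle _; rewrite -pmulrn expnS natrM mulrC //.
Qed.

Lemma half_over l u p : (l < L)%N -> walk_bound G (2 ^ l.+1) u p ->
  valE (ldd l) (fun P =>
    (t < neg_count G (exactpot P) (path_edges u p))%N%:R) <= 2^-1.
Proof.
move=> lL wb; have [_ pG _ _] := wb.
apply: (@le_trans _ _ (valE (ldd l) (fun P =>
    (t < count (is_cut P) (path_edges u p))%N%:R))).
  apply: (le_valE_always (P := fun P => ordered_partition P (vset G))
    (@ldd_part l)) => P partP.
  rewrite ler_nat; case: (ltnP t (neg_count _ _ _)) => // over.
  by rewrite (leq_trans over) // neg_count_cut //; exact: path_edges_eset.
apply: valE_markov; apply: le_trans (expected_cuts lL wb) _.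
(* Markov needs 2Q + 1/2 <= (t + 1) / 2, and the right-hand side is 2Q + 1 for the budget t = 4Q +
   1. *)
have -> : t.+1%:R = 4%:R * (Q n)%:R + 2%:R :> R.
  by rewrite -natrM -natrD /t /neg_budget addn1 addn2.
by rewrite natrM; lra.
Qed.

Lemma ideal_all_over l u p : (l < L)%N -> walk_bound G (2 ^ l.+1) u p ->
  valE (ideal l) (fun Phi => (all_over u p Phi)%:R) <= 2^-1 ^+ N.
Proof.
case: l => [|l] lL wb.
  rewrite valE_det /= /all_over /= andbT ltnNge.
  rewrite (leq_trans (neg_count0 wb)) ?exprn_ge0 //.
  by rewrite /t /neg_budget addn1.
rewrite valE_ideal; under eq_valE do rewrite /all_over all_map.
rewrite valE_nseq_all lerXn2r ?nnegrE //; last exact: half_over.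
by apply: valE_ge0.
Qed.

Definition deviates Phi P : bool := `[< round_pot Phi P <> exactpot P >].

(** In the ideal process [Phi] is independent of the new partition, so the partition can be fixed
    first. This fixes the n walks to be handled, and a union bound over their end vertices
    applies. *)
Lemma ideal_deviates l : (l < L)%N ->
  valE (ideal l) (fun Phi => valE (ldd l.+1) (fun P => (deviates Phi P)%:R))
    <= n%:R * 2^-1 ^+ N.
Proof.
move=> lL; rewrite valE_exchange -[leRHS](valE_cst (ldd l.+1)).
have alwaysI : always (ldd l.+1) (fun o =>
    ordered_partition (tvalue o) (vset G) /\
    forall A : {set T}, A \in tvalue o -> forall u v, u \in A -> v \in A ->
      (dist R G0 u v <= (2 ^ l.+1)%N%:R%:E)%E).
  by move=> s; split; [exact: ldd_part | exact: ldd_diam].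
apply: (le_valE_always alwaysI (P := fun P => ordered_partition P (vset G) /\
  forall A : {set T}, A \in P -> forall u v, u \in A -> v \in A ->
      (dist R G0 u v <= (2 ^ l.+1)%N%:R%:E)%E)) => P [partP diam].
apply: (@le_trans _ _ (valE (ideal l) (fun Phi => \sum_(v in vset G)
    (all_over (block_walk G P v).1 (block_walk G P v).2 Phi)%:R))).
  apply: le_valE => Phi; rewrite /deviates; case: asboolP => [dev|_]; last first.
    by apply: sumr_ge0 => v _.
  have [v vG over] : exists2 v, v \in vset G &
      all_over (block_walk G P v).1 (block_walk G P v).2 Phi.
    apply: contrapT => none; apply: dev.
    apply: (round_pot_exact rG Hfewneg partP) => v vG.
    apply/negPn/negP; rewrite -all_predC => over; apply: none; exists v => //.
    by apply: sub_all over => phi /=; rewrite ltnNge.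
  by rewrite (bigD1 v) //= over lerDl sumr_ge0.
rewrite valE_sum mulr_natl -sumr_const; apply: ler_sum => v vG.
by apply: ideal_all_over => //; apply: block_walk_bound vG diam.
Qed.

Definition levels l : prog R (seq (potential T)) :=
  loop (iota 1 l) (fun l Phi => seq_all (nseq N (round Phi l))) [:: fun=> 0].

(* Ranging over all [g] with values in [0, 1], this bounds the distance in total
   variation; the induction step applies it to the probability that some
   partition of the next level deviates. *)
Lemma levels_ideal l g : (l <= L)%N -> (forall Phi, 0 <= g Phi <= 1) ->
  valE (levels l) g <=
  valE (ideal l) g + l%:R * (N%:R * (n%:R * 2^-1 ^+ N)).
Proof.
elim: l g => [|l IH] g lL g01; first by rewrite mul0r addr0.
rewrite /levels -[in iota _ _](addn1 l) iotaD cats1 valE_loop_rcons add1n -/(levels l).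
pose dev Phi := valE (seq_all (nseq N (ldd l.+1)))
  (fun Ps => (has (deviates Phi) Ps)%:R).
apply: (@le_trans _ _ (valE (levels l) (fun Phi => valE (ideal l.+1) g + dev Phi))).
  apply: le_valE => Phi; rewrite valE_ideal -valED.
  rewrite (@valE_nseq_map _ _ _ (ldd l.+1) _ (round_pot Phi)); last first.
    by move=> h; rewrite valE_round.
  (* If some partition deviates, the error term is 1 and [g <= 1] suffices. Otherwise the real and
     the ideal potentials coincide. *)
  apply: le_valE => Ps /=; case hP: (has _ Ps) => /=.
    have /andP[_ /le_trans] := g01 (map (round_pot Phi) Ps); apply.
    by rewrite lerDr; case/andP: (g01 (map exactpot Ps)).
  rewrite addr0 (_ : map _ _ = map exactpot Ps) //.
  elim: Ps hP => //= P Ps IHP /norP[/asboolP/contrapT -> /negbTE/IHP ->] //.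
rewrite valED valE_cst lerD2l -natr1 mulrDl mul1r addrC.
apply: (@le_trans _ _ (valE (ideal l) dev + l%:R * (N%:R * (n%:R * 2^-1 ^+ N)))).
  apply: IH; first exact: ltnW.
  move=> Phi; rewrite valE_ge0 // valE_le1 // => Ps.
  by case: has.
rewrite lerD2r.
apply: (@le_trans _ _ (valE (ideal l) (fun Phi =>
    N%:R * valE (ldd l.+1) (fun P => (deviates Phi P)%:R)))).
  by apply: le_valE => Phi; exact: valE_nseq_has.
by rewrite valEZ ler_wpM2l // ideal_deviates.
Qed.

Lemma feasible_ideal : (0 < N)%N -> (0 < L)%N ->
  valE (ideal L) (fun Phi => (~~ feasible G (head (fun=> 0) Phi))%:R) = 0.
Proof.
move=> N0 L0; have [l EL] : exists l, L = l.+1 by exists L.-1; rewrite prednK.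
have [k EN] : exists k, N = k.+1 by exists N.-1; rewrite prednK.
(* Only the first of the N partitions matters: the returned [head] is its potential, and N > 0
   excludes the default of [head]. *)
rewrite EL valE_ideal EN valE_seq_all_cons -EL.
apply/eqP; rewrite eq_le valE_ge0 ?andbT => [|P]; last exact: valE_ge0.
rewrite -[leRHS](valE_cst (ldd L)).
have alwaysI : always (ldd L) (fun o =>
    ordered_partition (tvalue o) (vset G) /\
    forall e, e \in eset G -> ~~ is_cut (tvalue o) e).
  by move=> s; split; [exact: ldd_part | exact: ldd_uncut].
apply: (le_valE_always alwaysI (P := fun P => ordered_partition P (vset G) /\
  forall e, e \in eset G -> ~~ is_cut P e)) => P [partP uncut] /=.
rewrite valE_cst (_ : feasible G (exactpot P)) //.
by apply/forall_inP => e eG; apply: uncut_nonneg => //; exact: uncut.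
Qed.

Lemma sssp_feasible : (0 < N)%N -> (0 < L)%N ->
  1 - L%:R * (N%:R * (n%:R * 2^-1 ^+ N)) <=
  Pr (restricted_sssp cwhp Q tau dirldd fewneg G)
     (fun o => feasible G (tvalue o)).
Proof.
move=> N0 L0; apply: Pr_lbound.
rewrite valE_seqc valE_det valE_seqc.
under eq_valE do rewrite valE_det.
apply: le_trans (@levels_ideal L
  (fun Phi => (~~ feasible G (head (fun=> 0) Phi))%:R) _ _) _ => //.
  by move=> Phi; rewrite ler0n lern1 leq_b1.
by rewrite feasible_ideal // add0r.
Qed.

End Coupling.

(** * Logarithms *)

Section Logarithms.
Variable R : realType.
Implicit Types (n : nat) (c : R).

Lemma ln2_gt0 : 0 < ln 2 :> R.
Proof. by rewrite ln_gt0 // ltr1n. Qed.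

Lemma log2_ge0 n : (0 < n)%N -> 0 <= log2 R n.
Proof.
by move=> n0; apply: divr_ge0; rewrite ?(ltW ln2_gt0) // ln_ge0 // ler1n.
Qed.

Lemma up_log_log2 x : (1 < x)%N -> (up_log 2 x)%:R <= log2 R x + 1.
Proof.
move=> x1; have /andP[lt _] := up_log_bounds (isT : 1 < 2)%N x1.
have x0 : (0 < x)%N by exact: ltnW.
have u0 : (0 < up_log 2 x)%N by rewrite up_log_gt0 x1.
rewrite -(prednK u0) -natr1 lerD2r /log2 ler_pdivlMr ?ln2_gt0 //.
rewrite mulr_natl -lnXn ?ltr0n // -natrX ler_ln ?posrE ?ltr0n ?expn_gt0 //.
by rewrite ler_nat ltnW.
Qed.

Lemma levels_le n : (0 < n)%N ->
  (up_log 2 (2 * n ^ 2))%:R <= 2 * log2 R n + 2.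
Proof.
move=> n0; have n2 : (1 < 2 * n ^ 2)%N by rewrite -[X in (X < _)%N]/(1 * 1)%N; nia.
apply: le_trans (up_log_log2 n2) _.
have -> : log2 R (2 * n ^ 2)%N = 1 + 2 * log2 R n.
  have nR : 0 < n%:R :> R by rewrite ltr0n.
  rewrite /log2 natrM natrX lnM ?posrE ?exprn_gt0 // lnXn // mulrDl divff.
    by rewrite mulr2n mulrDl; ring.
  by rewrite gt_eqF ?ln2_gt0.
by lra.
Qed.

Lemma rounds_bounds c n : 0 < c -> (0 < n)%N ->
  (2 + c) * log2 R n <= (absz (Num.ceil ((2 + c) * log2 R n)))%:R
    <= (2 + c) * log2 R n + 1.
Proof.
move=> c0 n0; set x := _ * _.
have x0 : 0 <= x by rewrite mulr_ge0 ?log2_ge0 // addr_ge0 // ltW.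
have /andP[lt ge] := ceil_itv x.
have c0' : 0 <= Num.ceil x by rewrite -(ler_int R) (le_trans x0).
rewrite natr_absz ger0_norm // ge /=; move: lt; rewrite intrB; lra.
Qed.

(** With the base 2 logarithm, 2^(-(2+c) log n) is n^(-(2+c)), and rounding the exponent up only
    helps. *)
Lemma half_pow_rounds c n : 0 < c -> (0 < n)%N ->
  2^-1 ^+ absz (Num.ceil ((2 + c) * log2 R n)) <= n%:R `^ (- (2 + c)).
Proof.
move=> c0 n0; have /andP[] := rounds_bounds c0 n0.
set N := absz _ => le _.
have nR : 0 < n%:R :> R by rewrite ltr0n.
have h0 : 0 < 2^-1 ^+ N :> R by rewrite exprn_gt0 // invr_gt0.
rewrite -ler_ln ?posrE // ?powR_gt0 // ln_powR lnXn ?invr_gt0 // lnV ?posrE //.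
have l2 := ln2_gt0.
rewrite mulNrn mulNr lerN2 -[leRHS]mulr_natl; apply: le_trans (ler_wpM2r (ltW l2) le).
by rewrite /log2 -mulrA divfK // gt_eqF.
Qed.

(** At x = ln n, two of the three factors dominate L and N up to constants, and the third absorbs
    these constants. *)
Lemma cubic_le_exp (x : R) : 0 <= x -> (1 + x / 3) ^+ 3 <= expR x.
Proof.
move=> x0; have -> : expR x = expR (x / 3) ^+ 3.
  by rewrite -expRM_natl; congr expR; field.
by rewrite lerXn2r ?nnegrE ?expR_ge0 ?expR_ge1Dx // addr_ge0 // divr_ge0.
Qed.

(** Once L N <= n, the product is at most n * n * n^(-(2+c)) = n^(-c). This is where the summand 2
    in the number of rounds is spent. *)
Lemma failure_probability_small c : 0 < c -> exists n0 : nat,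
  forall n, (n0 <= n)%N -> (0 < n)%N ->
    (up_log 2 (2 * n ^ 2))%:R *
      ((absz (Num.ceil ((2 + c) * log2 R n)))%:R *
        (n%:R * 2^-1 ^+ absz (Num.ceil ((2 + c) * log2 R n))))
    <= n%:R `^ (- c).
Proof.
move=> c0; pose a : R := (ln 2)^-1.
have a0 : 0 < a by rewrite invr_gt0 ln2_gt0.
(* With y = 1 + ln n / 3, the two factors bound L / y and N / y. The threshold below forces ln n >=
   3A, hence y >= A and L N <= A y^2 <= y^3 <= n. *)
pose A := (6 * a + 2) * ((2 + c) * (3 * a) + 1).
exists (Num.bound (expR (3 * A))) => n n_ge n0.
have nR : 0 < n%:R :> R by rewrite ltr0n.
have xA : 3 * A <= ln n%:R.
  rewrite -(expRK (3 * A)) ler_ln ?posrE ?expR_gt0 //.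
  by apply/ltW/(lt_le_trans (archi_boundP (expR_ge0 _))); rewrite ler_nat.
have := levels_le n0; have := rounds_bounds c0 n0; have := half_pow_rounds c0 n0.
have x0 : 0 <= ln n%:R :> R by rewrite ln_ge0 // ler1n.
rewrite /log2 -/a; set x := ln n%:R in xA x0 *.
move: (absz _) (up_log _ _) => N L hN /andP[_ Nle] Lle.
have [y yE] : exists y, y = 1 + x / 3 by eexists.
have LN : L%:R * N%:R <= n%:R :> R.
  have xy : x = 3 * y - 3 by rewrite yE; field.
  have y1 : 1 <= y by rewrite yE lerDl divr_ge0.
  have Ly : L%:R <= (6 * a + 2) * y.
    apply: le_trans Lle _; rewrite xy; nra.
  have Ny : N%:R <= ((2 + c) * (3 * a) + 1) * y.
    apply: le_trans Nle _; rewrite xy.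
    have : 0 < (2 + c) * a by rewrite mulr_gt0 // addr_gt0.
    nra.
  apply: (@le_trans _ _ (y ^+ 3)); last first.
    by rewrite -[leRHS]lnK ?posrE // yE cubic_le_exp.
  apply: le_trans (ler_pM _ _ Ly Ny) _ => //.
  rewrite mulrACA -/A -expr2 [y ^+ 3]exprS ler_wpM2r ?sqr_ge0 //.
  by move: xA; rewrite xy; lra.
rewrite mulrA; apply: le_trans (ler_pM _ _ LN (ler_wpM2l _ hN)) _ => //.
have nn : n%:R = n%:R `^ 1 :> R by rewrite powRr1 // ltW.
rewrite {1 2}nn -!powRD ?(gt_eqF nR) ?implybT //.
by rewrite (_ : 1 + (1 - (2 + c)) = - c) //; ring.
Qed.

Lemma pow_levels_small (K : R) : 0 <= K -> exists n0 : nat,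
  forall n, (n0 <= n)%N -> (0 < n)%N ->
    (2 ^ up_log 2 (2 * n ^ 2))%N%:R * (K / n%:R ^+ 8) <= 2^-1.
Proof.
(* Since 2^L <= 4 n^2, the condition n >= 8K gives 2^L K <= n^3 / 2, which is more than enough
   against n^8. *)
move=> K0; exists (Num.bound (8 * K)) => n n_ge n0.
have nR : 1 <= n%:R :> R by rewrite ler1n.
have Kn : 8 * K <= n%:R.
  apply/ltW/(lt_le_trans (archi_boundP _)); first by rewrite mulr_ge0.
  by rewrite ler_nat.
have n2 : (1 < 2 * n ^ 2)%N by nia.
have := up_log_gtn (isT : 1 < 2)%N n2.
have u0 : (0 < up_log 2 (2 * n ^ 2))%N by rewrite up_log_gt0 n2.
move: (up_log _ _) u0 => [//|L] _ /= lt.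
have {}lt : (2 ^ L.+1 <= 4 * n ^ 2)%N by rewrite expnS; lia.
rewrite mulrA ler_pdivrMr ?exprn_gt0 ?(lt_le_trans ltr01) //.
apply: (@le_trans _ _ (4 * n%:R ^+ 2 * K)).
  by rewrite ler_wpM2r // -natrX -natrM ler_nat.
have n3 : n%:R ^+ 3 <= n%:R ^+ 8 :> R by rewrite ler_weXn2l.
apply: (@le_trans _ _ (2^-1 * n%:R ^+ 3)); last by rewrite ler_wpM2l // invr_ge0.
rewrite exprSr; have := sqr_ge0 (n%:R : R); nra.
Qed.

End Logarithms.

(** * Costs *)

Section Costs.
Variable R : realType.

(** The invariant [I] records what the cost of the continuation needs to know about the result, such
    as being a partition or the number of potentials. *)
Definition costs A (c : prog R A) (I : A -> Prop) (w h : R) : Prop :=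
  always c (fun o => [/\ I (tvalue o), (twork o)%:R <= w & (tspan o)%:R <= h]).

Lemma costsW A (c : prog R A) (I J : A -> Prop) w h w' h' :
  costs c I w h -> (forall a, I a -> J a) -> w <= w' -> h <= h' ->
  costs c J w' h'.
Proof.
move=> cI IJ ww hh s; have [Is ws hs] := cI s.
by split; [exact: IJ | exact: le_trans ww | exact: le_trans hh].
Qed.

Lemma costs_det A (a : timed A) :
  costs (det R a) (eq^~ (tvalue a)) (twork a)%:R (tspan a)%:R.
Proof. by case. Qed.
Arguments costs_det {A} a.

Lemma costs_seqc A B (c : prog R A) (f : A -> prog R B) I J w1 h1 w2 h2 :
  costs c I w1 h1 -> (forall a, I a -> costs (f a) J w2 h2) ->
  costs (seqc c f) J (w1 + w2) (h1 + h2).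
Proof.
move=> cI fJ; apply: always_seqc => s1 s2 /=; have [Is ws hs] := cI s1.
by have [Js ws2 hs2] := fJ _ Is s2; rewrite !natrD; split; rewrite ?lerD.
Qed.

Lemma costs_ret A B (c : prog R A) (f : A -> B) I (J : B -> Prop) w h :
  costs c I w h -> (forall a, I a -> J (f a)) ->
  costs (seqc c (fun a => ret R (f a))) J w h.
Proof.
move=> cI IJ; rewrite -[w]addr0 -[h]addr0; apply: costs_seqc cI _ => a Ia.
by apply: costsW (costs_det _) _ _ _ => //= _ ->; exact: IJ.
Qed.

Lemma costs_seq_all A I (s : seq I) (c : I -> prog R A) w h :
  (forall i, costs (c i) (fun=> True) w h) ->
  costs (seq_all [seq c i | i <- s]) (fun l => size l = size s)
    ((size s)%:R * w) ((size s)%:R * h).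
Proof.
move=> cwh; elim: s => [|i s IH] /=.
  by apply: costsW (costs_det _) _ _ _; rewrite ?mul0r //= => _ ->.
rewrite -natr1 !mulrDl !mul1r ![_ + w]addrC ![_ + h]addrC.
apply: costs_seqc (cwh i) _ => a _; apply: costs_ret IH _ => l /= <- //.
Qed.

Arguments costs_seq_all {A I} s {c w h}.

Lemma costs_join_all A (I : eqType) (s : seq I) (c : I -> prog R A) w h :
  0 <= h -> (forall i, i \in s -> costs (c i) (fun=> True) (w i) h) ->
  costs (join_all [seq c i | i <- s]) (fun=> True) (\sum_(i <- s) w i) h.
Proof.
move=> h0; elim: s => [|i s IH] cwh /=.
  by rewrite big_nil; apply: costsW (costs_det _) _ _ _.
have {}IH : costs (join_all [seq c i | i <- s]) (fun=> True) (\sum_(i <- s) w i) h.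
  by apply: IH => j js; apply: cwh; rewrite inE js orbT.
case=> s1 s2; have [_ w1 h1] := cwh i (mem_head _ _) s1.
have [_ w2 h2] := IH s2; rewrite big_cons; split => //=.
  by rewrite natrD lerD.
by rewrite /maxn; case: ifP.
Qed.

Lemma costs_par_all A (I : eqType) tau (s : seq I) (c : I -> prog R A) w h :
  0 <= h -> (forall i, i \in s -> costs (c i) (fun=> True) (w i) h) ->
  costs (par_all tau [seq c i | i <- s]) (fun=> True)
    ((tau * size s)%N%:R + \sum_(i <- s) w i)
    ((tau * (up_log 2 (size s)).+1)%N%:R + h).
Proof.
move=> h0 cwh; rewrite -(size_map c s).
apply: (costs_seqc (costs_det (Timed tt _ _))) => _ _.
exact: costs_join_all.
Qed.

Lemma costs_loop A (I : Type) (idx : seq I) (f : I -> A -> prog R A) a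
    (J : A -> Prop) w h :
  J a -> (forall i b, J b -> costs (f i b) J w h) ->
  costs (loop idx f a) J ((size idx)%:R * w) ((size idx)%:R * h).
Proof.
move=> + fJ; elim: idx a => [|i idx IH] a Ja /=.
  by apply: costsW (costs_det _) _ _ _; rewrite ?mul0r //= => _ ->.
rewrite -natr1 !mulrDl !mul1r ![_ + w]addrC ![_ + h]addrC.
by apply: costs_seqc (fJ i a Ja) _ => b; exact: IH.
Qed.

End Costs.

Arguments costs_det {R A} a.
Arguments costs_seq_all {R A I} s {c w h}.

Section Superadditive.
Variable W : nat -> nat -> nat.

Lemma superadditive_mono : superadditive W ->
  forall a b a' b', (a <= a')%N -> (b <= b')%N -> (W a b <= W a' b')%N.
Proof.
move=> HW a b a' b' aa bb; rewrite -(subnKC aa) -(subnKC bb).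
exact: leq_trans (leq_addr _ _) (HW _ _ _ _).
Qed.

Lemma superadditive_sum I (s : seq I) (a b : I -> nat) : superadditive W ->
  (\sum_(i <- s) W (a i) (b i) <= W (\sum_(i <- s) a i) (\sum_(i <- s) b i))%N.
Proof.
move=> HW; elim: s => [|i s IH]; rewrite ?big_nil // !big_cons.
by apply: leq_trans (HW _ _ _ _); rewrite leq_add2l.
Qed.

Lemma max_superadditive_mono : max_superadditive W ->
  forall a b a' b', (a <= a')%N -> (b <= b')%N -> (W a b <= W a' b')%N.
Proof.
move=> HW a b a' b' aa bb; rewrite -(subnKC aa) -(subnKC bb).
exact: leq_trans (leq_maxl _ _) (HW _ _ _ _).
Qed.

End Superadditive.

(** * Work and span of the algorithm *)

Section AlgorithmCosts.
Variables (R : realType) (W S : nat -> nat -> nat) (Q : nat -> nat).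
Variables (cwhp : R) (tau : nat) (dirldd : dirldd_proc R) (fewneg : fewneg_proc).
Hypothesis HWadd : superadditive W.
Hypothesis HSmax : max_superadditive S.
Hypothesis HWread : forall n m, (n + m <= W n m)%N.
Hypothesis HSread : forall n m, (0 < n)%N -> (1 <= S n m)%N.
Variables (T : finType) (G : graph T).

Let n := nverts G.
Let m := nedges G.
Let t := neg_budget Q G.
Let N := num_rounds cwhp G.
Let L := num_levels G.
Let G0 := nonneg_part G.

Hypothesis n_gt0 : (0 < n)%N.

Variable C : nat.
Hypothesis fewneg_costs : forall A phi, let H := induced_subgraph G A in
  (0 < nverts H)%N ->
  (twork (fewneg H phi t) <= C * W (nverts H * t) (nedges H * t))%N /\
  (tspan (fewneg H phi t) <= C * S (nverts H * t) (nedges H * t))%N.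

Variables p1 p2 p3 mu lam : R.
Hypotheses (p1_ge0 : 0 <= p1) (p2_ge0 : 0 <= p2) (p3_ge0 : 0 <= p3).
Hypothesis (mu_ge : N.+1%:R <= mu) (lam_ge : L.+1%:R <= lam).
Hypothesis W_scale : (W (n * t) (m * t))%:R <= (W n m)%:R * p2.
Hypothesis S_scale : (S (n * t) (m * t))%:R <= (S n m)%:R * p3.
Hypothesis ldd_costs : forall l, costs (dirldd G0 (2 ^ l)%N)
  (fun P => ordered_partition P (vset G)) ((W n m)%:R * p1) ((S n m)%:R * p1).

Local Notation Wn := ((W n m)%:R : R).
Local Notation Sn := ((S n m)%:R : R).
Local Notation tauR := (tau%:R : R).

Let mu_ge0 : 0 <= mu. Proof. exact: le_trans (ler0n _ _) mu_ge. Qed.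
Let lam_ge0 : 0 <= lam. Proof. exact: le_trans (ler0n _ _) lam_ge. Qed.
Let Sn_ge1 : 1 <= Sn. Proof. by rewrite ler1n HSread. Qed.
Let n_le : n%:R <= Wn.
Proof. by rewrite ler_nat; apply: leq_trans (HWread n m); exact: leq_addr. Qed.

Lemma nedges_le : (m <= n ^ 2)%N.
Proof. by rewrite -mulnn -finset.cardsX; apply: subset_leq_card; exact: eset_sub. Qed.

Lemma input_size_le : (n + m <= 2 * n ^ 2)%N.
Proof. by rewrite mul2n -addnn leq_add ?nedges_le // -mulnn leq_pmull. Qed.

(** The number of levels thus also bounds the logarithmic factors of sorting the input and of
    forking over the blocks. *)
Lemma up_log_le_levels k : (k <= 2 * n ^ 2)%N -> (up_log 2 k).+1%:R <= lam.
Proof. by move=> kn; apply: le_trans lam_ge; rewrite ler_nat ltnS leq_up_log. Qed.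

(** The work stays in terms of the block, since it is summed over blocks later. The span enters a
    maximum and is at once bounded in terms of the whole graph. *)
Lemma costs_solve_block Phi A : (size Phi <= N.+1)%N ->
  (0 < nverts (induced_subgraph G A))%N ->
  costs (solve_block R Q tau fewneg G Phi (induced_subgraph G A)) (fun=> True)
    (mu * (C * W (nverts (induced_subgraph G A) * t)
                 (nedges (induced_subgraph G A) * t))%N%:R
     + mu * (tauR * (nverts (induced_subgraph G A))%:R))
    (mu * (C%:R * (Sn * p3)) + tauR).
Proof.
set H := induced_subgraph G A => sPhi nH.
have sPhiR : (size Phi)%:R <= mu by apply: le_trans mu_ge; rewrite ler_nat.
have SH : (S (nverts H * t) (nedges H * t) <= S (n * t) (m * t))%N.
  apply: max_superadditive_mono => //; rewrite leq_mul2r; apply/orP; right.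
    by apply: subset_leq_card; exact: finset.subsetIl.
  by apply: subset_leq_card; exact: finset.subsetIl.
apply: (@costs_seqc _ _ _ _ _ (fun=> True)).
  apply: (@costsW _ _ _ _ _ ((size Phi)%:R * (C * W (nverts H * t) (nedges H * t))%N%:R)
    ((size Phi)%:R * (C * S (n * t) (m * t))%N%:R)) (costs_seq_all _ _) _ _ _ => //.
  - move=> phi; have [fw fs] := fewneg_costs phi nH.
    apply: costsW (costs_det _) _ _ _ => //; rewrite ler_nat //.
    by apply: leq_trans fs _; rewrite leq_mul2l SH orbT.
  - by rewrite ler_wpM2r.
  - by apply: ler_pM => //; rewrite natrM ler_wpM2l.
move=> ds _; apply: costs_ret (costsW (costs_det _) _ _ _) _ => //=.
by rewrite !natrM mulrCA ler_wpM2r // mulr_ge0.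
Qed.

(** The factor over W(n, m), with summands in program order: partitioning, sorting, forking, solving
    the blocks, combining. *)
Definition round_work : R :=
  p1 + (tauR * lam + ((tauR + mu * (C%:R * p2 + tauR)) + tauR)).

Definition round_span : R :=
  p1 + (tauR * lam + ((tauR * lam + (mu * (C%:R * p3) + tauR)) + tauR)).

Lemma costs_round Phi l : (size Phi <= N.+1)%N ->
  costs (ldd_round Q tau dirldd fewneg G G0 Phi l) (fun=> True)
    (Wn * round_work) (Sn * round_span).
Proof.
move=> sPhi; rewrite /round_work /round_span !(mulrDr Wn p1) !(mulrDr Sn p1).
apply: costs_seqc (@ldd_costs l) _ => P partP.
rewrite (mulrDr Wn (tauR * lam)) (mulrDr Sn (tauR * lam)).
apply: costs_seqc (costsW (costs_det _) (fun _ _ => I) _ _) _ => /=.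
- rewrite natrM natrM -mulrA [leRHS]mulrCA ler_wpM2l //.
  apply: ler_pM => //; last first.
    exact: up_log_le_levels input_size_le.
  by rewrite ler_nat HWread.
- rewrite natrM mulrCA ler_wpM2l // -[leLHS]mul1r; apply: ler_pM => //.
  exact: up_log_le_levels input_size_le.
move=> _ _; rewrite (mulrDr Wn _ tauR) (mulrDr Sn _ tauR).
apply: (@costs_seqc _ _ _ _ _ (fun=> True)); last first.
  move=> phis _; apply: costs_ret (costsW (costs_det _) (fun _ _ => I) _ _) _ => //=.
    by rewrite natrM mulrC ler_wpM2r.
  by rewrite -[leLHS]mul1r ler_wpM2r.
have sizeP : (size P <= n)%N := size_part partP.
have h_ge0 : 0 <= mu * (C%:R * (Sn * p3)) + tauR.
  by rewrite addr_ge0 // !mulr_ge0.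
have block_gt0 A : A \in P -> (0 < nverts (induced_subgraph G A))%N.
  move=> AP; have /finset.set0Pn[x xA] := part_neq0 partP AP.
  apply/card_gt0P; exists x; rewrite finset.inE xA andbT.
  exact: (part_sub partP AP xA).
have block_costs A (AP : A \in P) := costs_solve_block sPhi (block_gt0 A AP).
apply: costsW (costs_par_all h_ge0 block_costs) _ _ _ => //.
- rewrite mulrDr lerD //.
    by rewrite natrM mulrC ler_wpM2r // (le_trans _ n_le) // ler_nat.
  rewrite big_split /= -!big_distrr /= -mulrDr [leRHS]mulrCA ler_wpM2l //.
  rewrite mulrDr lerD //; last first.
    rewrite mulrC ler_wpM2r // (le_trans _ n_le) // -natr_sum ler_nat.
    apply: sum_card_part partP _ _ id _ _ => A e.
    by rewrite finset.inE.
  under eq_bigr do rewrite natrM.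
  rewrite -big_distrr /= mulrCA ler_wpM2l // (le_trans _ W_scale) //.
  rewrite -natr_sum ler_nat.
  (* Distinct blocks share neither vertices nor induced edges, so the block sizes add up to at most
     n and m. Each edge is charged to the block of its source. *)
  apply: leq_trans (superadditive_sum _ _ _ HWadd) _.
  apply: superadditive_mono => //; rewrite -big_distrl leq_mul2r; apply/orP; right.
    by apply: sum_card_part partP _ _ id _ _ => A e; rewrite finset.inE.
  apply: sum_card_part partP _ _ fst _ _ => A e.
  by rewrite !finset.inE => /and3P[-> ->].
- rewrite mulrDr lerD //.
    rewrite natrM mulrCA ler_wpM2l // -[leLHS]mul1r; apply: ler_pM => //.
    apply: up_log_le_levels; apply: leq_trans input_size_le.
    exact: leq_trans sizeP (leq_addr _ _).
  rewrite mulrDr lerD //; first by rewrite [leRHS]mulrCA [X in _ <= mu * X]mulrCA.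
  by rewrite -[leLHS]mul1r ler_wpM2r.
Qed.

Lemma costs_restricted_sssp :
  costs (restricted_sssp cwhp Q tau dirldd fewneg G) (fun=> True)
    (Wn * (tauR + lam * (mu * round_work))) (Sn * (tauR + lam * (mu * round_span))).
Proof.
have rw0 : 0 <= round_work.
  by rewrite /round_work !addr_ge0 // !mulr_ge0 // addr_ge0 // mulr_ge0.
have rs0 : 0 <= round_span.
  by rewrite /round_span !addr_ge0 // !mulr_ge0.
rewrite (mulrDr Wn) (mulrDr Sn).
apply: costs_seqc (costsW (costs_det _) (fun _ _ => I) _ _) _ => /=.
- by rewrite natrM mulrC ler_wpM2r // ler_nat HWread.
- by rewrite -[leLHS]mul1r ler_wpM2r.
move=> _ _.
have NR : N%:R <= mu by apply: le_trans mu_ge; rewrite ler_nat.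
have LR : L%:R <= lam by apply: le_trans lam_ge; rewrite ler_nat.
apply: (@costs_ret _ _ _ _ _ (fun Phi => size Phi <= N.+1)%N); last by [].
(* The invariant allows N + 1 potentials because the initial list has one element even when N = 0,
   as happens for n = 1. *)
apply: costsW (@costs_loop _ _ _ _ _ _ (fun Phi => size Phi <= N.+1)%N
  (mu * (Wn * round_work)) (mu * (Sn * round_span)) _ _) _ _ _ => //.
- move=> l Phi sPhi.
  have -> : nseq N (ldd_round Q tau dirldd fewneg G G0 Phi l) =
      [seq ldd_round Q tau dirldd fewneg G G0 Phi l | _ <- nseq N tt].
    by rewrite map_nseq.
  apply: costsW (costs_seq_all _ (fun=> @costs_round Phi l sPhi)) _ _ _ => [Phi'||].
  + by rewrite size_nseq => ->.
  + by rewrite size_nseq ler_wpM2r // mulr_ge0.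
  + by rewrite size_nseq ler_wpM2r // mulr_ge0.
- rewrite size_iota [leRHS]mulrCA [X in _ <= lam * X]mulrCA ler_wpM2r // !mulr_ge0 //.
- rewrite size_iota [leRHS]mulrCA [X in _ <= lam * X]mulrCA ler_wpM2r // !mulr_ge0 //.
Qed.

End AlgorithmCosts.

(** * Distances between reachable vertices at the last level *)

Section Reachability.
Variables (R : realType) (T : finType) (G : graph T).
Hypothesis rG : restricted G.

Lemma nonneg_part_wt e : e \in eset (nonneg_part G) ->
  0 <= wt (nonneg_part G) e <= (nverts (nonneg_part G))%:Z.
Proof.
case: rG => wG _ /wG /andP[_ le]; rewrite /= le_max lexx /= ge_max le andbT.
by [].
Qed.

(** A simple path has fewer than n edges of weight at most n, and n^2 <= 2^L. So DirLDD cuts nothing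
    at the last level. *)
Lemma connect_dist u v : u \in vset G -> connect (erel (nonneg_part G)) u v ->
  (dist R (nonneg_part G) u v <= (2 ^ num_levels G)%N%:R%:E)%E.
Proof.
move=> uG /connectP[p0 /shortenP[p pG up _] ->].
have up' : dipath (nonneg_part G) u p (last u p) by rewrite /dipath uG pG eqxx.
apply: le_trans (walk_dist_le R up') _; rewrite lee_fin.
rewrite pmulrn ler_int.
have sp := uniq_walk_size (H := nonneg_part G) uG pG up.
have wle : weight (nonneg_part G) (path_edges u p) <= (size p * nverts G)%:Z.
  rewrite /weight big_seq; apply: (@le_trans _ _
    (\sum_(e <- path_edges u p | e \in path_edges u p) (nverts G)%:Z)).
    by apply: ler_sum => e /(path_edges_eset pG)/nonneg_part_wt/andP[].
  rewrite -big_seq big_const_seq count_predT iter_addr_0 size_path_edges.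
  by rewrite -mulr_natr natz -PoszM mulnC.
apply: le_trans wle _; rewrite lez_nat.
apply: leq_trans (up_logP (2 * nverts G ^ 2) (isT : (1 < 2)%N)).
have : (size p < nverts G)%N := sp.
nia.
Qed.

End Reachability.

(** * Polynomials in log n as bounds *)

Section Polylogs.
Variable R : realType.

(* The O only controls large [n]; the constant coefficient covers the others. *)
Lemma polylog_bound (f : nat -> nat) :
  (fun n : nat => (f n)%:R : R^o) =O_\oo (fun n : nat => log2 R n ^+ 2 : R^o) ->
  exists q : {poly R}, forall n, (f n)%:R <= q.[log2 R n].
Proof.
move=> /eqOP[M [_ HM]].
have [|n1 _ Hn1] := HM (`|M| + 1); first by rewrite (le_lt_trans (ler_norm M)) // ltrDl.
pose q : {poly R} := (\sum_(i < n1) f i)%N%:R%:P + (`|M| + 1)%:P * 'X^2.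
exists q => n; rewrite /q hornerD hornerM !hornerC hornerXn.
case: (ltnP n n1) => nn1.
  apply: (@le_trans _ _ (\sum_(i < n1) f i)%N%:R).
    by rewrite ler_nat (bigD1 (Ordinal nn1)) //= leq_addr.
  by rewrite lerDl mulr_ge0 ?sqr_ge0 ?addr_ge0.
have := Hn1 n nn1; rewrite /= normr_nat (ger0_norm (sqr_ge0 _)) => le.
by rewrite -[leLHS]add0r lerD.
Qed.

(* [p ^+ 2 + 1] dominates [p] and, unlike it, takes only nonnegative values. *)
Lemma le_polylog_pos (p : {poly R}) n x y :
  le_polylog p n x y -> le_polylog (p ^+ 2 + 1) n x y.
Proof.
move=> le; apply: le_trans le _; rewrite ler_wpM2l // hornerD horner_exp hornerC.
by have := sqr_ge0 (p.[log2 R n] - 1); have := sqr_ge0 p.[log2 R n]; nra.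
Qed.

Lemma horner_sqr1_ge0 (p : {poly R}) x : 0 <= (p ^+ 2 + 1).[x].
Proof. by rewrite hornerD horner_exp hornerC addr_ge0 // sqr_ge0. Qed.

End Polylogs.

(** * Feasibility for large n, and the cost bounds for all nonempty graphs *)

Theorem theorem3p1 (R : realType) (W S : nat -> nat -> nat) (Q : nat -> nat)
    (cwhp : R) (tau : nat) (dirldd : dirldd_proc R) (fewneg : fewneg_proc)
    (HWadd : superadditive W)
    (HSmax : max_superadditive S)
    (HWread : forall n m, (n + m <= W n m)%N)
    (HSread : forall n m, (0 < n)%N -> (1 <= S n m)%N)
    (HWscale : polylog_scaling R W)
    (HSscale : polylog_scaling R S)
    (HQ : (fun n : nat => (Q n)%:R : R^o) =O_\oo
          (fun n : nat => log2 R n ^+ 2 : R^o))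
    (Hc : 0 < cwhp)
    (Hdirldd : dirldd_spec W S Q dirldd)
    (Hfewneg : fewneg_spec R W S fewneg) :
  (exists n0 : nat, forall (T : finType) (G : graph T),
     restricted G -> (n0 <= nverts G)%N ->
     1 - (nverts G)%:R `^ (- cwhp)
       <= Pr (restricted_sssp cwhp Q tau dirldd fewneg G)
             (fun o => feasible G (tvalue o)))
  /\
  (exists p : {poly R}, forall (T : finType) (G : graph T),
     restricted G -> (0 < nverts G)%N ->
     always (restricted_sssp cwhp Q tau dirldd fewneg G) (fun o =>
       le_polylog p (nverts G) (twork o) (W (nverts G) (nedges G)) /\
       le_polylog p (nverts G) (tspan o) (S (nverts G) (nedges G)))).
Proof.
(* Degree 1 suffices, as the weights of G_{>=0} are at most n. *)
have [K [p HKp]] := Hdirldd 1%N.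
have wle (T : finType) (G : graph T) : restricted G ->
    forall e, e \in eset (nonneg_part G) ->
    0 <= wt (nonneg_part G) e <= (nverts (nonneg_part G) ^ 1)%:Z.
  by move=> rG e eG; rewrite expn1; exact: nonneg_part_wt.
have pow_gt0 l : (1 <= 2 ^ l)%N by rewrite expn_gt0.
split.
  have [n1 Hn1] := failure_probability_small Hc.
  (* The sign of [K] is not known, so its absolute value takes its place. *)
  have [n2 Hn2] := pow_levels_small (normr_ge0 K).
  (* From n >= 2 on, log n > 0 and there is at least one round. *)
  exists (maxn 2 (maxn n1 n2)) => T G rG; rewrite !geq_max => /and3P[nge2 nge1 nge].
  have n_gt0 : (0 < nverts G)%N by exact: ltnW.
  have ldd l := HKp T (nonneg_part G) (2 ^ l)%N (wle T G rG) (pow_gt0 l).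
  apply: le_trans (@sssp_feasible R W S Q cwhp tau dirldd fewneg Hfewneg T G rG
    `|K| (normr_ge0 K) (Hn2 _ nge n_gt0) _ _ _ _ _ _).
  - by rewrite lerD2l lerN2; exact: Hn1.
  - by move=> l; case: (ldd l).
  - move=> l s A AP u v uA vA; case: (ldd l) => _ diam _ _ _.
    by have [] := diam s A AP u v uA vA.
  - move=> l e eG; case: (ldd l) => _ _ cut _ _.
    apply: le_trans (cut e eG) _.
    by rewrite lerD2l ler_wpM2r ?ler_norm.
  - case: (ldd (num_levels G)) => _ _ _ uncut _; refine (uncut _) => u v uG vG.
    by case/andP=> uv vu; split; exact: connect_dist.
  - have /andP[+ _] := rounds_bounds Hc n_gt0.
    rewrite -(ltr0n R); apply: lt_le_trans; rewrite mulr_gt0 ?addr_gt0 //.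
    by rewrite divr_gt0 ?ln2_gt0 // ln_gt0 // ltr1n.
  - by rewrite up_log_gt0 /=; nia.
have [q Hq] := polylog_bound HQ.
pose qt : {poly R} := 4%:P * q + 1.
have tle n : (4 * Q n + 1)%N%:R <= qt.[log2 R n].
  rewrite /qt !(hornerD, hornerM, hornerC).
  by rewrite natrD natrM lerD2r ler_wpM2l.
have [p2 Hp2] := HWscale qt; have [p3 Hp3] := HSscale qt.
have [C HC] := Hfewneg.
pose P1 := p ^+ 2 + 1; pose P2 := p2 ^+ 2 + 1; pose P3 := p3 ^+ 2 + 1.
(* In the variable log n, [lam] and [mu] are the upper bounds for L and N, each increased by 1. *)
pose lam : {poly R} := 2%:P * 'X + 3%:P.
pose mu : {poly R} := (2 + cwhp)%:P * 'X + 2%:P.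
pose pw : {poly R} := tau%:R%:P + lam * (mu *
  (P1 + (tau%:R%:P * lam +
    ((tau%:R%:P + mu * (C%:R%:P * P2 + tau%:R%:P)) + tau%:R%:P)))).
pose ps : {poly R} := tau%:R%:P + lam * (mu *
  (P1 + (tau%:R%:P * lam +
    ((tau%:R%:P * lam + (mu * (C%:R%:P * P3) + tau%:R%:P)) + tau%:R%:P)))).
(* A single polynomial has to bound both work and span; with the squares it dominates [pw] and [ps]
   whatever their signs. *)
exists (pw ^+ 2 + ps ^+ 2 + 1) => T G rG n_gt0 s.
have le_pw x y : le_polylog pw (nverts G) x y ->
    le_polylog (pw ^+ 2 + ps ^+ 2 + 1) (nverts G) x y.
  move=> /le_polylog_pos le; apply: le_trans le _; rewrite ler_wpM2l //.
  rewrite !(hornerD, horner_exp, hornerC).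
  by rewrite lerD2r lerDl sqr_ge0.
have le_ps x y : le_polylog ps (nverts G) x y ->
    le_polylog (pw ^+ 2 + ps ^+ 2 + 1) (nverts G) x y.
  move=> /le_polylog_pos le; apply: le_trans le _; rewrite ler_wpM2l //.
  rewrite !(hornerD, horner_exp, hornerC).
  by rewrite lerD2r lerDr sqr_ge0.
have ldd l := HKp T (nonneg_part G) (2 ^ l)%N (wle T G rG) (pow_gt0 l).
have few A phi := HC T (induced_subgraph G A) phi (neg_budget Q G)
  (@induced_nonneg_cycle T G rG A).
have t_gt0 : (0 < neg_budget Q G)%N by rewrite /neg_budget addn1.
have [] := @costs_restricted_sssp R W S Q cwhp tau dirldd fewneg HWadd HSmax
  HWread HSread T G n_gt0 C _ P1.[log2 R (nverts G)] P2.[log2 R (nverts G)]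
  P3.[log2 R (nverts G)] mu.[log2 R (nverts G)] lam.[log2 R (nverts G)]
  (horner_sqr1_ge0 _ _) (horner_sqr1_ge0 _ _) (horner_sqr1_ge0 _ _) _ _ _ _ _ s.
- by move=> A phi H nH; case: (few A phi) => _ _ fw fs; split; [exact: fw | exact: fs].
- have /andP[_ le] := rounds_bounds Hc n_gt0.
  rewrite /mu !(hornerD, hornerM, hornerC, hornerX) -natr1.
  by apply: le_trans (lerD le (lexx 1)) _; lra.
- have le := levels_le R n_gt0.
  rewrite /lam !(hornerD, hornerM, hornerC, hornerX) -natr1.
  by apply: le_trans (lerD le (lexx 1)) _; lra.
- by apply: le_polylog_pos; apply: Hp2 => //; exact: tle.
- by apply: le_polylog_pos; apply: Hp3 => //; exact: tle.
- move=> l s'; case: (ldd l) => part _ _ _ /(_ n_gt0 s')[cw cs].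
  by split; [exact: part | exact: le_polylog_pos | exact: le_polylog_pos].
move=> _ work span; split; [apply: le_pw | apply: le_ps].
- move: work; rewrite /le_polylog /round_work /pw.
  by rewrite !(hornerD, hornerM, hornerC).
- move: span; rewrite /le_polylog /round_span /ps.
  by rewrite !(hornerD, hornerM, hornerC).
Qed.
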